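(* Let $\mathcal{H}$ be a Hilbert space, $\Lambda$ an index set, and $q=\{q_{\alpha\beta}\in\mathbb{T}:\alpha\ne\beta\in\Lambda\}$ with $q_{\alpha\beta}=q_{\beta\alpha}^{-1}$. Let $\mathcal{T}=\{T_\alpha:\alpha\in\Lambda\}$ be a family of contractions on $\mathcal{H}$ with $T_\alpha T_\beta=q_{\alpha\beta}T_\beta T_\alpha$ for all $\alpha\ne\beta$. Then $\mathcal{T}$ admits a regular $q$-unitary dilation in each of the following cases: (1) every $T_\alpha$ is an isometry; (2) $\mathcal{T}$ is doubly $q$-commuting, i.e. additionally $T_\alpha T_\beta^*=\overline{q_{\alpha\beta}}\,T_\beta^*T_\alpha$ for all $\alpha\ne\beta$; (3) $\Lambda$ is countable and $\sum_{\alpha\in\Lambda}\|T_\alpha\|^2\le 1$.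
   Context: For an integer $m$, $m^+=\max\{m,0\}$ and $m^-=-\min\{m,0\}$. The family $\mathcal{T}$ admits a regular $q$-unitary dilation if there exist a Hilbert space $\mathcal{K}\supseteq\mathcal{H}$ and unitaries $\{U_\alpha:\alpha\in\Lambda\}$ on $\mathcal{K}$ with $U_\alpha U_\beta=q_{\alpha\beta}U_\beta U_\alpha$ for all $\alpha\ne\beta$, such that for every $k$, all distinct $\alpha_1,\dots,\alpha_k\in\Lambda$ and all $m_{\alpha_1},\dots,m_{\alpha_k}\in\mathbb{Z}$, \[ \prod_{1\le i<j\le k} q_{\alpha_i\alpha_j}^{-m_{\alpha_i}^+m_{\alpha_j}^-}\big[(T_{\alpha_1}^{m_{\alpha_1}^-})^*\cdots(T_{\alpha_k}^{m_{\alpha_k}^-})^*\big]\big[T_{\alpha_1}^{m_{\alpha_1}^+}\cdots T_{\alpha_k}^{m_{\alpha_k}^+}\big]=P_{\mathcal{H}}U_{\alpha_1}^{m_{\alpha_1}}\cdots U_{\alpha_k}^{m_{\alpha_k}}|_{\mathcal{H}}, \] where $P_{\mathcal{H}}$ is the orthogonal projection of $\mathcal{K}$ onto $\mathcal{H}$. *)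

(* Defs.v *)
From mathcomp Require Import all_boot all_order all_algebra.
From mathcomp Require Import complex.
From mathcomp Require Import classical_sets reals.
From Stdlib Require List.

Set Implicit Arguments.
Unset Strict Implicit.
Unset Printing Implicit Defensive.

Import Order.TTheory GRing.Theory Num.Theory.
Local Open Scope ring_scope.
Local Open Scope complex_scope.
Local Open Scope classical_set_scope.

(* The inner product is linear in the first and conjugate-linear in the      *)
(* second variable.  For z : R[i], 0 < z means z is real and positive.       *)
Section Hilbert.
Variable R : realType.

Record hilbert := Hilbert {
  hcar :> lmodType R[i];
  ip : hcar -> hcar -> R[i];
  ip_linl : forall (a : R[i]) (x y z : hcar), ip (a *: x + y) z = a * ip x z + ip y z;
  ip_conj : forall x y : hcar, ip y x = (ip x y)^*;
  ip_posdef : forall x : hcar, x != 0 -> 0 < ip x x;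
  ip_complete : forall u : nat -> hcar,
    (forall e : R, 0 < e -> exists N : nat, forall m n : nat, (N <= m)%N -> (N <= n)%N ->
        Num.sqrt (complex.Re (R:=R) (ip (u m - u n) (u m - u n))) < e) ->
    exists l : hcar, forall e : R, 0 < e -> exists N : nat, forall n : nat, (N <= n)%N ->
        Num.sqrt (complex.Re (R:=R) (ip (u n - l) (u n - l))) < e
}.

Definition hnorm (H : hilbert) (x : H) : R := Num.sqrt (complex.Re (R:=R) (ip x x)).

(* Bounded linear operators H1 -> H2, together with their (unique) adjoint. *)
Record bop (H1 H2 : hilbert) := BOp {
  bfun :> H1 -> H2;
  badj : H2 -> H1;
  bfun_linear : forall (a : R[i]) (x y : H1), bfun (a *: x + y) = a *: bfun x + bfun y;
  bfun_bounded : exists M : R, forall x : H1, hnorm (bfun x) <= M * hnorm x;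
  badj_spec : forall (x : H1) (y : H2), ip (bfun x) y = ip x (badj y)
}.

Definition is_contraction (H : hilbert) (T : bop H H) : Prop :=
  forall x : H, hnorm (T x) <= hnorm x.

Definition is_isometry (H1 H2 : hilbert) (T : bop H1 H2) : Prop :=
  forall x : H1, hnorm (T x) = hnorm x.

Definition is_unitary (H : hilbert) (U : bop H H) : Prop :=
  (forall x : H, badj U (U x) = x) /\ (forall x : H, U (badj U x) = x).

Definition opnorm (H : hilbert) (T : bop H H) : R :=
  sup [set r | exists x : H, hnorm x <= 1 /\ r = hnorm (T x)].

Definition mpos (m : int) : nat := match m with Posz n => n | Negz _ => 0%N end.
Definition mneg (m : int) : nat := match m with Posz _ => 0%N | Negz n => n.+1 end.

(* integer powers of a is_unitary: U^m, with U^{-1} = U^* *)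
Definition upow (K : hilbert) (U : bop K K) (m : int) : K -> K :=
  match m with Posz n => iter n U | Negz n => iter n.+1 (badj U) end.

Section Family.
Variables (Lambda : Type) (H : hilbert).

(* A list s = [(a_1,m_1);...;(a_k,m_k)] encodes distinct indices a_i with
   integer exponents m_i. *)

Fixpoint qcoef (q : Lambda -> Lambda -> R[i]) (s : seq (Lambda * int)%type) : R[i] :=
  match s with
  | [::] => 1
  | p :: s' => (\prod_(p' <- s') q p.1 p'.1 ^ (- ((mpos p.2 * mneg p'.2)%N)%:Z))
               * qcoef q s'
  end.

Definition posprod (T : Lambda -> bop H H) (s : seq (Lambda * int)%type) (x : H) : H :=
  foldr (fun p y => iter (mpos p.2) (T p.1) y) x s.

Definition adjprod (T : Lambda -> bop H H) (s : seq (Lambda * int)%type) (x : H) : H :=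
  foldr (fun p y => iter (mneg p.2) (badj (T p.1)) y) x s.

Definition uprod (K : hilbert) (U : Lambda -> bop K K) (s : seq (Lambda * int)%type) (x : K) : K :=
  foldr (fun p y => upow (U p.1) p.2 y) x s.

(* Regular q-is_unitary dilation.  H is identified with its image under the
   isometric embedding V : H -> K, so P_H B |_H corresponds to V^* B V. *)
Definition regular_q_unitary_dilation (q : Lambda -> Lambda -> R[i])
    (T : Lambda -> bop H H) : Prop :=
  exists (K : hilbert) (V : bop H K) (U : Lambda -> bop K K),
    is_isometry V /\
    (forall a, is_unitary (U a)) /\
    (forall a b, a <> b -> forall y : K, U a (U b y) = q a b *: U b (U a y)) /\
    (forall s : seq (Lambda * int)%type, List.NoDup (map fst s) ->
       forall x : H, qcoef q s *: adjprod T s (posprod T s x) = badj V (uprod U s (V x))).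

End Family.
End Hilbert.

(* Main.v *)
From HB Require Import structures.
Require Import Defs.
From mathcomp Require Import all_boot all_order all_algebra.
From mathcomp Require Import complex boolp functions.
From mathcomp Require Import classical_sets reals.
From mathcomp Require Import zify ring lra.
From Stdlib Require List.
Set Implicit Arguments.
Unset Strict Implicit.
Unset Printing Implicit Defensive.
Import Order.TTheory GRing.Theory Num.Theory.
Local Open Scope ring_scope.
Local Open Scope complex_scope.

(* A family has a regular dilation as soon as Brehmer's condition holds: for every finite set u
   of indices, the form sum_(v subset u) (-1)^|v| <T_v x, T_v y> is positive.  In each of the
   three cases this condition is checked by induction on u.

   For finitely many indices, the condition allows one to make the operators invertible and
   isometric one at a time.  To treat T_a, replace a set X with positive definite kernel k by
   int * X with the Toeplitz kernel k(T_a^((n-m)^+) x, T_a^((m-n)^+) y): T_a becomes the shift,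
   while T_b becomes (n, x) |-> (n, q_ba^n T_b x), and Brehmer's condition for the remaining
   indices is inherited because the Toeplitz kernel is a telescoping sum of k and of
   k - k(T_a, T_a).  The values <U_w h, U_w' g> on words w, w' are forced by the commutation
   relations and by the regularity formula, so the kernels obtained from different finite sets
   of indices agree and define one kernel on all words over an arbitrary index set.  Its
   Kolmogorov space carries the dilation. *)

(** * Positive definite kernels *)

(** Working on bare sets postpones every quotient, completion and boundedness question to a single
    Kolmogorov construction at the end. On a stage the commutation relations are equations between
    points, up to the scalar action, so they can be used inside words without equivalence classes;
    the condition [|q a b| = 1] makes the phases drop out of the kernels. The obstacle is an
    infinite [Lambda]: stages built from different finite lists are not nested, and each depends on
    the order of its letters. The lemmas on words therefore choose their scalars and words before
    the stage, so that these depend on letters alone. The comparison with the inner product of [H]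
    is imposed on disjoint words only: with a common letter of [L] the two sides differ in general,
    because [tau a] is isometric on the stage while T_a need not be. *)

Lemma mpos_subn (m : int) (a b : nat) : m = a%:Z - b%:Z -> mpos m = (a - b)%N.
Proof. by case: m => d /=; rewrite ?NegzE => h; lia. Qed.

Lemma eq_big_In (V : nmodType) (I : Type) (s : seq I) (F G : I -> V) :
  (forall i, List.In i s -> F i = G i) -> \sum_(i <- s) F i = \sum_(i <- s) G i.
Proof.
elim: s => [|a s IH] h; first by rewrite !big_nil.
by rewrite !big_cons h ?IH //=; [move=> i si; apply: h; right|left].
Qed.

Section PositiveKernels.
Variable R : realType.
Local Notation C := R[i].

Definition psd (X : Type) (k : X -> X -> C) : Prop :=
  forall s : seq (C * X), 0 <= \sum_(p <- s) \sum_(r <- s) p.1 * r.1^*%C * k p.2 r.2.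

(** A test combination is pushed forward along [f] with its coefficients multiplied by [w]. *)
Lemma psd_weighted (X Y : Type) (k : Y -> Y -> C) (w : X -> C) (f : X -> Y) :
  psd k -> psd (fun x y => w x * (w y)^*%C * k (f x) (f y)).
Proof.
move=> kP s; have := kP [seq (p.1 * w p.2, f p.2) | p <- s].
rewrite big_map; congr (0 <= _); apply: eq_bigr => p _.
rewrite big_map; apply: eq_bigr => r _ /=.
by rewrite rmorphM /= !mulrA; congr (_ * _); ring.
Qed.

Lemma psd_sum (X J : Type) (js : seq J) (k : J -> X -> X -> C) :
  (forall j, psd (k j)) -> psd (fun x y => \sum_(j <- js) k j x y).
Proof.
move=> kP s; rewrite (_ : \sum_(p <- s) _ =
  \sum_(j <- js) \sum_(p <- s) \sum_(r <- s) p.1 * r.1^*%C * k j p.2 r.2).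
  by apply: sumr_ge0 => j _; apply: kP.
rewrite [RHS]exchange_big; apply: eq_bigr => p _ /=.
rewrite [RHS]exchange_big; apply: eq_bigr => r _ /=.
by rewrite mulr_sumr.
Qed.

(** * Positivity of Toeplitz kernels *)

Section Toeplitz.
Variables (X : Type) (tau : X -> X) (k : X -> X -> C).

Definition defect1 x y := k x y - k (tau x) (tau y).

Definition toeplitz (z z' : int * X) : C :=
  k (iter (mpos (z.1 - z'.1)) tau z.2) (iter (mpos (z'.1 - z.1)) tau z'.2).

(** Removing one common [tau] from both arguments changes the value of [k] by a value of [defect1].
    The term [j = 0] is the starting value k(tau^n x, tau^m y); after min(n,m) removals only the
    difference of the exponents is left. *)
Lemma toeplitz_telescope (n m : nat) x y :
  k (iter (n - m) tau x) (iter (m - n) tau y) =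
  \sum_(0 <= j < (minn n m).+1)
     (if j is 0%N then k else defect1) (iter (n - j) tau x) (iter (m - j) tau y).
Proof.
set f := fun j => k (iter (n - j) tau x) (iter (m - j) tau y).
transitivity (f (minn n m)).
  by rewrite /f; case: (leqP n m) => h; congr (k (iter _ _ _) (iter _ _ _)); lia.
have : (minn n m <= minn n m)%N by [].
elim: {-2}(minn n m) => [|j IH] hj; first by rewrite big_nat1.
rewrite big_nat_recr //= -IH; last exact: ltnW.
rewrite /defect1 -!iterS /f.
have -> : (n - j.+1).+1 = (n - j)%N by lia.
have -> : (m - j.+1).+1 = (m - j)%N by lia.
by rewrite addrC subrK.
Qed.

Lemma toeplitz_psd : psd k -> psd defect1 -> psd toeplitz.
Proof.
move=> k0 k1 s.
(* Only differences of first coordinates enter [toeplitz], so a common shift by [N] moves all of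
   them into the naturals; [nu] is the shifted coordinate. *)
pose N := (\sum_(p <- s) `|p.2.1|)%N.
pose nu (z : int * X) := absz (z.1 + N%:Z).
have nuE p : List.In p s -> (nu p.2)%:Z = p.2.1 + N%:Z.
  move=> ps; rewrite /nu; suff : (`|p.2.1| <= N)%N by lia.
  move: ps; rewrite /N; clear; elim: s => //= a s IH [->|/IH]; rewrite big_cons; lia.
pose M := (\sum_(p <- s) (nu p.2).+1)%N.
have nuM p : List.In p s -> (nu p.2 < M)%N.
  rewrite /M; elim: (s) => //= a l IH [->|/IH]; rewrite big_cons; lia.
(* The indicator weights extend the telescoping sum, whose length depends on the pair, to the common
   range [j < M], and each [K j] stays positive by [psd_weighted]. *)
pose K j (z z' : int * X) := ((j <= nu z)%N%:R : C) * ((j <= nu z')%N%:R : C)^*%C *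
   (if j is 0%N then k else defect1) (iter (nu z - j) tau z.2) (iter (nu z' - j) tau z'.2).
have KP j : psd (K j).
  apply: (@psd_weighted _ _ _ (fun z => (j <= nu z)%N%:R) (fun z => iter (nu z - j) tau z.2)).
  by case: j.
have := @psd_sum _ _ (index_iota 0 M) K KP s; congr (0 <= _).
apply: eq_big_In => p ps; apply: eq_big_In => r rs; congr (_ * _).
rewrite /toeplitz.
have -> : mpos (p.2.1 - r.2.1) = (nu p.2 - nu r.2)%N.
  by apply: mpos_subn; move: (nuE _ ps) (nuE _ rs); lia.
have -> : mpos (r.2.1 - p.2.1) = (nu r.2 - nu p.2)%N.
  by apply: mpos_subn; move: (nuE _ ps) (nuE _ rs); lia.
rewrite toeplitz_telescope.
have le : ((minn (nu p.2) (nu r.2)).+1 <= M)%N by have := nuM _ ps; lia.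
rewrite (big_cat_nat (leq0n _) le) /= [X in _ + X]big_nat_cond [X in _ + X]big1 ?addr0; last first.
  move=> j /andP[/andP[h _] _]; rewrite /K.
  have [h1|h1] := leqP j (nu p.2); last by rewrite !mul0r.
  have [h2|h2] := leqP j (nu r.2); last by rewrite rmorph_nat mulr0 mul0r.
  lia.
apply: eq_big_nat => j /andP[_ h]; rewrite /K.
have -> : (j <= nu p.2)%N by lia.
have -> : (j <= nu r.2)%N by lia.
by rewrite rmorph_nat !mul1r.
Qed.

End Toeplitz.
End PositiveKernels.

(** * Making the operators invertible one at a time *)

Section Defect.
Variables (R : realType) (Lambda : eqType).
Local Notation C := R[i].

(** Unfolded, this is Brehmer's alternating sum of (-1)^|v| k(tau_v x, tau_v y) over the sublists v
    of [u]. Peeling one letter at a time makes the head letter's contribution a [defect1]. *)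
Fixpoint defect (X : Type) (tau : Lambda -> X -> X) (u : seq Lambda) (k : X -> X -> C) x y : C :=
  if u is a :: u' then defect tau u' k x y - defect tau u' k (tau a x) (tau a y) else k x y.

Definition word (X : Type) (tau : Lambda -> X -> X) (p : seq Lambda) (x : X) : X := foldr tau x p.

Definition disjoint_words (p p' : seq Lambda) : bool := all (fun a => a \notin p') p.

End Defect.

Lemma mpos_oppn (n : nat) : mpos (- n%:Z) = 0%N.
Proof. by case: n. Qed.

Lemma mpos_sub (m : int) : (mpos m)%:Z - (mpos (- m))%:Z = m.
Proof. by case: m => n; rewrite ?NegzE ?opprK ?mpos_oppn ?subr0 //= sub0r. Qed.

Lemma unit_conj (R : realType) (z : R[i]) : `|z| = 1 -> z^*%C = z^-1.
Proof. by move=> z1; rewrite invc_norm z1 expr1n invr1 mul1r. Qed.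

Lemma unit_neq0 (R : realType) (z : R[i]) : `|z| = 1 -> z != 0.
Proof. by move=> z1; rewrite -normr_eq0 z1 oner_eq0. Qed.

Section Stages.
Variables (R : realType) (Lambda : eqType) (H : hilbert R).
Local Notation C := R[i].
Variables (q : Lambda -> Lambda -> C) (T : Lambda -> H -> H).
Hypothesis q_unit : forall a b, a != b -> `|q a b| = 1.
Hypothesis q_inv : forall a b, a != b -> q a b = (q b a)^-1.

(* A stage is a kernel extending that of H on which the letters of L already act as invertible
   isometries; only a set with a scalar action is needed, no vector space structure. *)
Record stage (L : seq Lambda) := Stage {
  car :> Type;
  sc : C -> car -> car;
  ker : car -> car -> C;
  tau : Lambda -> car -> car;
  sig : Lambda -> car -> car;
  emb : H -> car;
  sc1 : forall x, sc 1 x = x;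
  scA : forall c d x, sc c (sc d x) = sc (c * d) x;
  tau_sc : forall a c x, tau a (sc c x) = sc c (tau a x);
  sig_sc : forall a c x, a \in L -> sig a (sc c x) = sc c (sig a x);
  tau_comm : forall a b x, a != b -> tau a (tau b x) = sc (q a b) (tau b (tau a x));
  ker_herm : forall x y, ker y x = (ker x y)^*%C;
  ker_sc : forall c x y, ker (sc c x) y = c * ker x y;
  ker_psd : forall u, uniq u -> disjoint_words u L -> psd (defect tau u ker);
  tau_iso : forall a x y, a \in L -> ker (tau a x) (tau a y) = ker x y;
  tauK : forall a x, a \in L -> sig a (tau a x) = x;
  sigK : forall a x, a \in L -> tau a (sig a x) = x;
  emb_ker : forall p p' h g, disjoint_words p p' ->
    ker (word tau p (emb h)) (word tau p' (emb g)) = ip (word T p h) (word T p' g)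
}.

Section Step.
Variables (L : seq Lambda) (S : stage L) (a : Lambda).
Hypothesis aL : a \notin L.
Local Notation t := (@tau L S).
Local Notation k := (@ker L S).

Definition step_sc (c : C) (z : int * S) : int * S := (z.1, sc c z.2).

(* The shift U_a must satisfy T_b U_a^n = q_ba^n U_a^n T_b, whence the phase. *)
Definition step_tau (b : Lambda) (z : int * S) : int * S :=
  if b == a then (z.1 + 1, z.2) else (z.1, sc (q b a ^ z.1) (t b z.2)).
Definition step_sig (b : Lambda) (z : int * S) : int * S :=
  if b == a then (z.1 - 1, z.2) else (z.1, sc (q b a ^ (- z.1)) (sig b z.2)).

Lemma iter_tau_sc n b c (x : S) : iter n (t b) (sc c x) = sc c (iter n (t b) x).
Proof. by elim: n => //= n ->; rewrite tau_sc. Qed.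

Lemma iter_tau_comm n b (x : S) : b != a ->
  iter n (t a) (t b x) = sc (q b a ^ (- n%:Z)) (t b (iter n (t a) x)).
Proof.
move=> ba; elim: n => [|n IH]; first by rewrite /= expr0z sc1.
rewrite iterS IH tau_sc tau_comm 1?eq_sym // scA; congr sc.
rewrite (q_inv (a := a)) 1?eq_sym // -exprN1 -expfzDr; last exact: unit_neq0 (q_unit ba).
congr (_ ^ _); lia.
Qed.

Lemma ker_scr c (x y : S) : k x (sc c y) = c^*%C * k x y.
Proof. by rewrite ker_herm ker_sc rmorphM /= -ker_herm. Qed.

Lemma defect_sc u c d (x y : S) :
  defect t u k (sc c x) (sc d y) = c * d^*%C * defect t u k x y.
Proof.
elim: u c d x y => [|b u IH] c d x y /=; first by rewrite ker_sc ker_scr mulrA.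
by rewrite !tau_sc !IH mulrBr.
Qed.

(** For [b] other than [a], the phases q_ba^n and the conjugate of q_ba^m meet the phases from
    moving T_b through the powers of T_a. The total exponent is (n - m) - ((n - m)^+ - (m - n)^+) =
    0. *)
Lemma toeplitz_step_tau u b z z' :
  toeplitz (t a) (defect t u k) (step_tau b z) (step_tau b z') =
  if b == a then toeplitz (t a) (defect t u k) z z'
  else toeplitz (t a) (fun x y => defect t u k (t b x) (t b y)) z z'.
Proof.
rewrite /toeplitz /step_tau; case: eqVneq => [_|ba] /=.
  by rewrite !opprD !addrA !(addrAC _ 1) !addrK.
rewrite !iter_tau_sc !iter_tau_comm // !scA defect_sc -[RHS]mul1r; congr (_ * _).
have q0 := unit_neq0 (q_unit ba).
have conjX (n : int) : (q b a ^ n)^*%C = q b a ^ (- n).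
  by rewrite rmorphXz ?unitfE //= (unit_conj (q_unit ba)) exprz_inv.
rewrite rmorphM /=.
rewrite [X in _ * (X * _)]conjX [X in _ * (_ * X)]conjX -!expfzDr // -[RHS](expr0z (q b a));
  congr (_ ^ _).
have := mpos_sub (z.1 - z'.1); rewrite opprB; move: (mpos _) (mpos _) => d e; lia.
Qed.

Lemma defect_toeplitz u : a \notin u -> forall z z',
  defect step_tau u (toeplitz (t a) k) z z' = toeplitz (t a) (defect t u k) z z'.
Proof.
elim: u => [|b u IH] //=; rewrite inE negb_or => /andP[ab au] z z'.
by rewrite !IH // toeplitz_step_tau eq_sym (negbTE ab).
Qed.

(** [toeplitz_psd] asks for positivity of the [u]-defect of [k] and of its further defect in [a],
    which is the defect for [a :: u]. This is why a stage records positivity for all [u] disjoint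
    from [L]. *)
Lemma defect_toeplitz_psd u : uniq u -> disjoint_words u (a :: L) ->
  psd (defect step_tau u (toeplitz (t a) k)).
Proof.
move=> uu; rewrite /disjoint_words => /allP uL.
have au : a \notin u by apply/negP => /uL; rewrite inE eqxx.
have uL' : disjoint_words u L by apply/allP => b /uL; rewrite inE negb_or => /andP[].
move=> s; under eq_bigr do under eq_bigr do rewrite defect_toeplitz //.
apply: toeplitz_psd; first exact: ker_psd.
have := @ker_psd _ S (a :: u); apply; first by rewrite /= au.
by rewrite /disjoint_words /= aL.
Qed.

(** The phases stored in [y] are those of moving every [a] to the front of the word, so restoring
    these letters gives back the original word. For disjoint words one of the two counts is 0, and
    [toeplitz] then applies [t a] the full number of times on one side and not at all on the
    other. *)
Lemma word_step_tau p (x : S) : exists y : S,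
  word step_tau p (0, x) = ((count_mem a p)%:Z, y) /\
  iter (count_mem a p) (t a) y = word t p x.
Proof.
elim: p => [|b p [y [IH1 IH2]]] /=; first by exists x.
rewrite IH1 /step_tau /=; case: eqVneq => [->|ba] /=.
  by exists y; rewrite -IH2 PoszD addrC.
eexists; split; first by rewrite add0n.
by rewrite add0n iter_tau_sc iter_tau_comm // scA -expfzDr ?subrr ?expr0z ?sc1 ?IH2 ?unit_neq0
  ?q_unit.
Qed.

Lemma step_emb_ker p p' h g : disjoint_words p p' ->
  toeplitz (t a) k (word step_tau p (0, emb S h)) (word step_tau p' (0, emb S g)) =
  ip (word T p h) (word T p' g).
Proof.
move=> pp'; rewrite -(emb_ker S) //.
have [y [-> <-]] := word_step_tau p (emb S h).
have [y' [-> <-]] := word_step_tau p' (emb S g).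
rewrite /toeplitz /=.
have [ap|/count_memPn ->] := boolP (a \in p).
  have /count_memPn -> : a \notin p' by move/allP: pp' => ->.
  by rewrite subr0 sub0r mpos_oppn.
by rewrite subr0 sub0r mpos_oppn.
Qed.

Definition stage_step : stage (a :: L).
Proof.
apply: (@Stage (a :: L) (int * S)%type step_sc (toeplitz (t a) k) step_tau step_sig
   (fun h => (0, emb S h))).
- by case=> n x; rewrite /step_sc sc1.
- by move=> c d [n x]; rewrite /step_sc scA.
- move=> b c [n x]; rewrite /step_sc /step_tau; case: ifP => //= _.
  by rewrite tau_sc !scA mulrC.
- move=> b c [n x]; rewrite inE /step_sc /step_sig; case: eqVneq => //= _ bL.
  by rewrite sig_sc // !scA mulrC.
- move=> b c [n x] bc; rewrite /step_tau /step_sc /=.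
  case: (eqVneq b a) bc => [->|ba] bc /=; case: eqVneq => [ca|ca] /=.
  + by rewrite ca eqxx in bc.
  + rewrite !scA; congr (_, sc _ _).
    by rewrite (q_inv bc) expfzDr ?unit_neq0 ?q_unit // expr1z mulrCA mulVf ?mulr1 ?unit_neq0
      ?q_unit.
  + rewrite ca !scA; congr (_, sc _ _).
    by rewrite expfzDr ?unit_neq0 ?q_unit // expr1z mulrC.
  + rewrite !tau_sc tau_comm // !scA; congr (_, sc _ _); ring.
- by case=> n x [m y]; rewrite /toeplitz -ker_herm.
- by move=> c [n x] [m y]; rewrite /toeplitz /= iter_tau_sc ker_sc.
- exact: defect_toeplitz_psd.
- move=> b z z' bL; have := toeplitz_step_tau [::] b z z' => /= ->.
  case: ifP => // ba; rewrite /toeplitz tau_iso //.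
  by move: bL; rewrite inE ba.
- move=> b [n x]; rewrite inE /step_sig /step_tau; case: eqVneq => /= [_ _|ba bL];
  first by rewrite addrK.
  by rewrite sig_sc // tauK // scA -expfzDr ?unit_neq0 ?q_unit // addNr expr0z sc1.
- move=> b [n x]; rewrite inE /step_sig /step_tau; case: eqVneq => /= [_ _|ba bL];
  first by rewrite subrK.
  by rewrite tau_sc // sigK // scA -expfzDr ?unit_neq0 ?q_unit // subrr expr0z sc1.
- exact: step_emb_ker.
Defined.

End Step.

Hypothesis T_sc : forall a c x, T a (c *: x) = c *: T a x.
Hypothesis T_comm : forall a b x, a != b -> T a (T b x) = q a b *: T b (T a x).
Hypothesis T_psd : forall u, uniq u -> psd (defect T u (@ip R H)).

Lemma ip_sc (c : C) (x y : H) : ip (c *: x) y = c * ip x y.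
Proof.
have h0 : ip (0 : H) y = 0.
  by have := ip_linl 1 0 0 y; rewrite scaler0 addr0 mul1r => /eqP;
    rewrite -subr_eq0 opprD addrA subrr sub0r oppr_eq0 => /eqP.
by rewrite -[c *: x]addr0 ip_linl h0 addr0.
Qed.

Definition stage_nil : stage [::].
Proof.
(* No letter belongs to [[::]], so the identity serves as default value for [sig]. *)
apply: (@Stage [::] H (fun c x => c *: x) (@ip R H) T (fun _ x => x) id) => //.
- by move=> x; rewrite scale1r.
- by move=> c d x; rewrite scalerA.
- exact: ip_conj.
- exact: ip_sc.
- by move=> u uu _; exact: T_psd.
Defined.

Lemma stage_exists L : uniq L -> inhabited (stage L).
Proof.
elim: L => [|a L IH] /=; first by move=> _; exists; exact: stage_nil.
by case/andP => aL /IH[S]; exists; exact: (stage_step S aL).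
Qed.

End Stages.

(** * The kernel on all words *)

Section GlobalKernel.
Variables (R : realType) (Lambda : eqType) (H : hilbert R).
Local Notation C := R[i].
Variables (q : Lambda -> Lambda -> C) (T Tadj : Lambda -> H -> H).
Hypothesis q_unit : forall a b, a != b -> `|q a b| = 1.
Hypothesis q_inv : forall a b, a != b -> q a b = (q b a)^-1.
Hypothesis T_lin : forall a c x y, T a (c *: x + y) = c *: T a x + T a y.
Hypothesis T_adj : forall a x y, ip (T a x) y = ip x (Tadj a y).
Hypothesis T_comm : forall a b x, a != b -> T a (T b x) = q a b *: T b (T a x).
Hypothesis T_psd : forall u, uniq u -> psd (defect T u (@ip R H)).
Local Notation stage := (stage q T).

Lemma word_cat (X : Type) (t : Lambda -> X -> X) p p' x :
  word t (p ++ p') x = word t p (word t p' x).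
Proof. exact: foldr_cat. Qed.

Lemma word_sc L (S : stage L) p c (x : S) :
  word (tau (s:=S)) p (sc c x) = sc c (word (tau (s:=S)) p x).
Proof. by elim: p => //= a p ->; rewrite tau_sc. Qed.

(** The scalar [d] is quantified before the stage: it depends on the letters only, which later makes
    the kernel independent of the stage. *)
Lemma word_tau_comm p a : exists d : C, forall L (S : stage L) (x : S),
  word (tau (s:=S)) p (tau a x) = sc d (tau a (word (tau (s:=S)) p x)).
Proof.
elim: p => [|b p [d IH]]; first by exists 1 => L S x; rewrite sc1.
have [->|ba] := eqVneq b a; first by exists d => L S x /=; rewrite IH tau_sc.
by exists (d * q b a) => L S x /=; rewrite IH tau_sc tau_comm // scA.
Qed.

Lemma word_word_comm p p' : exists d : C, forall L (S : stage L) (x : S),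
  word (tau (s:=S)) p (word (tau (s:=S)) p' x) = sc d (word (tau (s:=S)) p' (word (tau (s:=S)) p
    x)).
Proof.
elim: p' => [|b p' [d IH]]; first by exists 1 => L S x; rewrite sc1.
have [e he] := word_tau_comm p b.
by exists (e * d) => L S x /=; rewrite he IH tau_sc scA.
Qed.

Lemma word_tau_iso L (S : stage L) p (x y : S) : {subset p <= L} ->
  ker (word (tau (s:=S)) p x) (word (tau (s:=S)) p y) = ker x y.
Proof.
elim: p => //= a p IH pL; rewrite tau_iso ?IH // => [b bp|]; apply: pL;
  rewrite inE ?bp ?orbT ?eqxx //.
Qed.

(* (a, true) stands for U_a and (a, false) for its inverse. *)
Definition letter (L : seq Lambda) (S : stage L) (l : Lambda * bool) (x : S) : S :=
  if l.2 then tau l.1 x else sig l.1 x.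

Definition signed_word (L : seq Lambda) (S : stage L) (w : seq (Lambda * bool)) (x : S) : S :=
  foldr (@letter L S) x w.

(** The word [r] plays the role of a common denominator. A leading inverse letter is cleared by
    appending the letter at the right end of [r]; a leading positive letter is commuted through [r]
    and joins the numerator [p]. *)
Lemma signed_word_clear w : exists r p c, [/\ {subset r <= map fst w}, {subset p <= map fst w} &
  forall L (S : stage L) (x : S), {subset map fst w <= L} ->
   word (tau (s:=S)) r (signed_word w x) = sc c (word (tau (s:=S)) p x)].
Proof.
elim: w => [|[a b] w [r [p [c [rw pw IH]]]]].
  by exists [::], [::], 1; split=> // L S x _; rewrite sc1.
have wL L : {subset a :: map fst w <= L} -> {subset map fst w <= L}.
  by move=> h x xw; apply: h; rewrite inE xw orbT.
case: b.
  have [d hd] := word_tau_comm r a.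
  exists r, (a :: p), (d * c); split => [x /rw h|x|L S x /wL h] /=.
  - by rewrite inE h orbT.
  - by rewrite !inE => /orP[->//|/pw ->]; rewrite orbT.
  - by rewrite /letter /= hd IH // tau_sc scA.
exists (rcons r a), p, c; split => [x|x /pw h|L S x h] /=.
- by rewrite mem_rcons !inE => /orP[->//|/rw ->]; rewrite orbT.
- by rewrite inE h orbT.
- by rewrite -cats1 word_cat /= sigK ?IH //; [exact: wL|apply: h; rewrite inE eqxx].
Qed.

(** A letter common to both words is commuted to the front of each and dropped, since [tau a]
    preserves the kernel; the induction runs on the length of the first word. *)
Lemma cancel_common_letters p p' : exists c r r', disjoint_words r r' /\
  forall L (S : stage L) (x y : S), {subset p <= L} ->
   ker (word (tau (s:=S)) p x) (word (tau (s:=S)) p' y) =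
   c * ker (word (tau (s:=S)) r x) (word (tau (s:=S)) r' y).
Proof.
move: {2}(size p) (leqnn (size p)) p' => n; elim: n p => [|n IH] p sp p'.
  by exists 1, [::], p'; split => // L S x y _; move: sp; rewrite leqn0 => /nilP ->; rewrite mul1r.
have [d|] := boolP (disjoint_words p p'); first by exists 1, p, p'; split => // *; rewrite mul1r.
case/allPn => a ap; rewrite negbK => ap'.
case/splitPr: ap sp => p1 p2 sp; case/splitPr: ap' => p1' p2'.
have [d hd] := word_tau_comm p1 a; have [d' hd'] := word_tau_comm p1' a.
have sp' : (size (p1 ++ p2) <= n)%N by move: sp; rewrite !size_cat /=; lia.
have [c [r [r' [dr IHr]]]] := IH _ sp' (p1' ++ p2').
exists (d * d'^*%C * c), r, r'; split=> // L S x y pL.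
have aL : a \in L by apply: pL; rewrite mem_cat inE eqxx orbT.
rewrite -!mulrA -IHr; last by move=> z; rewrite mem_cat => /orP[] h; apply: pL;
  rewrite mem_cat ?inE h ?orbT.
by rewrite !word_cat /= hd hd' ker_sc ker_scr tau_iso.
Qed.

(** Applying [r' ++ r] to both arguments keeps the kernel and clears the inverses on both sides,
    once [r] and [r'] are interchanged in the second argument. After cancelling common letters, the
    words are disjoint and [emb_ker] evaluates the kernel in [H]. *)
Lemma signed_pair w w' : exists c r r', disjoint_words r r' /\
  forall L (S : stage L) h g, {subset map fst w <= L} -> {subset map fst w' <= L} ->
   ker (signed_word w (emb S h)) (signed_word w' (emb S g)) =
   c * ip (word T r h) (word T r' g).
Proof.
have [r [p [c [rw pw hw]]]] := signed_word_clear w.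
have [r' [p' [c' [rw' pw' hw']]]] := signed_word_clear w'.
have [d hd] := word_word_comm r' r.
have [e [m [m' [dm hm]]]] := cancel_common_letters (r' ++ p) (r ++ p').
exists (c * (d * c')^*%C * e), m, m'; split => // L S h g wL wL'.
have sL : {subset r' ++ r <= L}.
  by move=> z; rewrite mem_cat => /orP[/rw'/wL'|/rw/wL].
rewrite -(word_tau_iso _ _ sL) !word_cat hw // hd hw' // !word_sc scA ker_sc ker_scr -!word_cat.
rewrite hm; last by move=> z; rewrite mem_cat => /orP[/rw'/wL'|/pw/wL].
by rewrite emb_ker // !mulrA.
Qed.

Lemma signed_pair_code w w' : exists t : C * (seq Lambda * seq Lambda),
  forall L (S : stage L) h g, {subset map fst w <= L} -> {subset map fst w' <= L} ->
   ker (signed_word w (emb S h)) (signed_word w' (emb S g)) =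
   t.1 * ip (word T t.2.1 h) (word T t.2.2 g).
Proof. by have [c [r [r' [_ e]]]] := signed_pair w w'; exists (c, (r, r')). Qed.

(** One choice per pair of words defines the kernel without naming a stage; [word_kernel_stage] then
    evaluates it on any stage with enough letters. *)
Definition pair_code w w' := projT1 (cid (signed_pair_code w w')).

Definition word_kernel (z z' : seq (Lambda * bool) * H) : C :=
  let t := pair_code z.1 z'.1 in t.1 * ip (word T t.2.1 z.2) (word T t.2.2 z'.2).

Lemma word_kernel_stage L (S : stage L) z z' : {subset map fst z.1 <= L} -> {subset map fst z'.1
  <= L} ->
  word_kernel z z' = ker (signed_word z.1 (emb S z.2)) (signed_word z'.1 (emb S z'.2)).
Proof.
by move=> zL zL'; rewrite (projT2 (cid (signed_pair_code z.1 z'.1)) L S).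
Qed.

Lemma stage_for (A : seq Lambda) : exists L (S : stage L), {subset A <= L}.
Proof.
have T_sc a c x : T a (c *: x) = c *: T a x.
  have T0 : T a 0 = 0 by have := T_lin a (-1) 0 0; rewrite scaler0 addr0 scaleN1r addNr.
  by rewrite -[c *: x]addr0 T_lin T0 addr0.
have [S] := stage_exists q_unit q_inv T_sc T_comm T_psd (undup_uniq A).
by exists (undup A), S => x; rewrite mem_undup.
Qed.

(** A test combination involves finitely many words, hence finitely many letters, and can be
    evaluated on a single stage. *)
Lemma word_kernel_psd : psd word_kernel.
Proof.
move=> s.
have [L [S AL]] := stage_for (flatten [seq map fst p.2.1 | p <- s]).
have sL p : List.In p s -> {subset map fst p.2.1 <= L}.
  move=> ps x xp; apply: AL; apply/flattenP; elim: s ps => //= z s IH [->|/IH[l ls xl]].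
    by exists (map fst p.2.1); rewrite ?inE ?eqxx.
  by exists l => //; rewrite inE ls orbT.
have kP : psd (@ker _ _ _ _ _ _ S) by apply: (@ker_psd _ _ _ _ _ _ S [::]).
have := psd_weighted (fun _ => 1) (fun z => signed_word z.1 (emb S z.2)) kP s.
congr (0 <= _); apply: eq_big_In => p ps; apply: eq_big_In => r rs.
by rewrite rmorph1 !mul1r (word_kernel_stage S) //; exact: sL.
Qed.

Lemma word_kernel_herm z z' : word_kernel z' z = (word_kernel z z')^*%C.
Proof.
have [L [S AL]] := stage_for (map fst z.1 ++ map fst z'.1).
have zL : {subset map fst z.1 <= L} by move=> x xz; apply: AL; rewrite mem_cat xz.
have zL' : {subset map fst z'.1 <= L} by move=> x xz; apply: AL; rewrite mem_cat xz orbT.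
by rewrite !(word_kernel_stage S) // ker_herm.
Qed.

Lemma word_kernel_letter l z z' : word_kernel (l :: z.1, z.2) (l :: z'.1, z'.2) = word_kernel z z'.
Proof.
have [L [S AL]] := stage_for (l.1 :: map fst z.1 ++ map fst z'.1).
have lL : l.1 \in L by apply: AL; rewrite inE eqxx.
have zL : {subset map fst z.1 <= L} by move=> x xz; apply: AL; rewrite inE mem_cat xz orbT.
have zL' : {subset map fst z'.1 <= L} by move=> x xz; apply: AL; rewrite inE mem_cat xz !orbT.
rewrite !(word_kernel_stage S) //=; try by move=> x; rewrite inE => /orP[/eqP ->//|]; auto.
rewrite /letter; case: l.2; first by rewrite tau_iso.
by rewrite -[LHS](tau_iso _ _ lL) !sigK.
Qed.

Lemma word_kernel_cancel a b z z' : word_kernel ((a, b) :: (a, ~~ b) :: z.1, z.2) z' =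
  word_kernel z z'.
Proof.
have [L [S AL]] := stage_for (a :: map fst z.1 ++ map fst z'.1).
have aL : a \in L by apply: AL; rewrite inE eqxx.
have zL : {subset map fst z.1 <= L} by move=> x xz; apply: AL; rewrite inE mem_cat xz orbT.
have zL' : {subset map fst z'.1 <= L} by move=> x xz; apply: AL; rewrite inE mem_cat xz !orbT.
rewrite !(word_kernel_stage S) //=; last by move=> x; rewrite !inE => /or3P[/eqP ->//|/eqP
  ->//|]; auto.
by case: b; rewrite /letter /= ?tauK ?sigK.
Qed.

Lemma word_kernel_comm a b z z' : a != b ->
  word_kernel ((a, true) :: (b, true) :: z.1, z.2) z' = q a b * word_kernel ((b, true) :: (a,
    true) :: z.1, z.2) z'.
Proof.
move=> ab; have [L [S AL]] := stage_for (a :: b :: map fst z.1 ++ map fst z'.1).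
have aL : a \in L by apply: AL; rewrite inE eqxx.
have bL : b \in L by apply: AL; rewrite !inE eqxx orbT.
have zL : {subset map fst z.1 <= L} by move=> x xz; apply: AL; rewrite !inE mem_cat xz !orbT.
have zL' : {subset map fst z'.1 <= L} by move=> x xz; apply: AL; rewrite !inE mem_cat xz !orbT.
rewrite !(word_kernel_stage S) //=; try by move=> x; rewrite !inE => /or3P[/eqP ->//|/eqP ->//|];
  auto.
by rewrite /letter /= tau_comm // ker_sc.
Qed.

Lemma word_kernel_positive p p' h g : disjoint_words p p' ->
  word_kernel ([seq (a, true) | a <- p], h) ([seq (a, true) | a <- p'], g) = ip (word T p h)
    (word T p' g).
Proof.
move=> pp'; have [L [S AL]] := stage_for (p ++ p').
have fstE (r : seq Lambda) : map fst [seq (a, true) | a <- r] = r by rewrite -map_comp map_id.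
rewrite (word_kernel_stage S) /= ?fstE; try by move=> x xz; apply: AL; rewrite mem_cat xz ?orbT.
have swE r x : signed_word (S := S) [seq (a, true) | a <- r] x = word (tau (s:=S)) r x.
  by elim: r => //= a r ->.
by rewrite !swE emb_ker.
Qed.

(** The vector [v] will be the projection onto [H] of the point attached to [z]. It exists because
    the word acting on [g] moves to the other side through adjoints. *)
Lemma word_kernel_repr z : exists v, forall g, word_kernel z ([::], g) = ip v g.
Proof.
have adj p x g : ip x (word T p g) = ip (foldl (fun y a => Tadj a y) x p) g.
  elim: p x => //= a p IH x; by rewrite -IH ip_conj T_adj -ip_conj.
pose t := pair_code z.1 [::].
by exists (t.1 *: foldl (fun y a => Tadj a y) (word T t.2.1 z.2) t.2.2) => g; rewrite ip_sc -adj.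
Qed.

End GlobalKernel.

(** * Semi-inner products *)

Section ComplexModulus.
Variable R : realType.
Local Notation C := R[i].
Local Notation Re := (complex.Re (R:=R)).
Local Notation Im := (complex.Im (R:=R)).

Definition cabs (z : C) : R := Re `|z|.

Lemma cabsE z : (cabs z)%:C = `|z|.
Proof. by rewrite /cabs RRe_real // normr_real. Qed.

Lemma cabs_ge0 z : 0 <= cabs z.
Proof. by rewrite -ler0c cabsE normr_ge0. Qed.

Lemma cabsM z w : cabs (z * w) = cabs z * cabs w.
Proof. by apply: complexI; rewrite rmorphM /= !cabsE normrM. Qed.

Lemma cabsD z w : cabs (z + w) <= cabs z + cabs w.
Proof. by rewrite -lecR rmorphD /= !cabsE ler_normD. Qed.

Lemma cabsN z : cabs (- z) = cabs z.
Proof. by rewrite /cabs normrN. Qed.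

Lemma cabsJ z : cabs (z^*%C) = cabs z.
Proof. by rewrite /cabs normcJ. Qed.

Lemma cabs1 : cabs 1 = 1.
Proof. by rewrite /cabs normr1. Qed.

Lemma cabs0 : cabs 0 = 0.
Proof. by rewrite /cabs normr0. Qed.

Lemma cabs_le0 z : cabs z <= 0 -> z = 0.
Proof.
move=> h; apply/eqP; rewrite -normr_eq0 -cabsE; apply/eqP.
by congr (_%:C); apply/eqP; rewrite eq_le h cabs_ge0.
Qed.

Lemma cabs_sqr z : cabs z ^+ 2 = Re z ^+ 2 + Im z ^+ 2.
Proof. by apply: complexI; rewrite rmorphXn /= cabsE -add_Re2_Im2. Qed.

Lemma mulJ_cabs z : z * z^*%C = (cabs z ^+ 2)%:C.
Proof. by rewrite -sqr_normc rmorphXn /= cabsE. Qed.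

Lemma conjNreal (x : R) (z c : C) : c = - (x%:C * z) -> c^*%C = - (x%:C * z^*%C).
Proof. by move=> ->; case: z => a b; congr (_ +i* _) => /=; ring. Qed.

Lemma Re_le_cabs z : `|Re z| <= cabs z.
Proof.
by rewrite -(ler_pXn2r (_ : 0 < 2)%N) ?nnegrE ?cabs_ge0 // cabs_sqr real_normK ?num_real // lerDl
  sqr_ge0.
Qed.

Lemma Im_le_cabs z : `|Im z| <= cabs z.
Proof.
by rewrite -(ler_pXn2r (_ : 0 < 2)%N) ?nnegrE ?cabs_ge0 // cabs_sqr real_normK ?num_real // lerDr
  sqr_ge0.
Qed.

Lemma cabs_le_ReIm z : cabs z <= `|Re z| + `|Im z|.
Proof.
rewrite -(ler_pXn2r (_ : 0 < 2)%N) ?nnegrE ?cabs_ge0 ?addr_ge0 // cabs_sqr.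
rewrite -(real_normK (num_real (Re z))) -(real_normK (num_real (Im z))).
have := normr_ge0 (Re z); have := normr_ge0 (Im z); nra.
Qed.

End ComplexModulus.

(** * Null sequences, complex limits and completeness of the scalars *)

Section Limits.
Variable R : realType.
Local Notation C := R[i].
Local Notation Re := (complex.Re (R:=R)).
Local Notation Im := (complex.Im (R:=R)).

(** The condition is one-sided: it is applied to norms and moduli, and for a constant it yields only
    [c <= 0]. *)
Definition null (f : nat -> R) := forall e, 0 < e -> exists N, forall n, (N <= n)%N -> f n < e.

Lemma null_le f g : (forall n, f n <= g n) -> null g -> null f.
Proof. by move=> fg g0 e /g0[N hN]; exists N => n /hN; apply: le_lt_trans. Qed.

Lemma null_add f g : null f -> null g -> null (fun n => f n + g n).
Proof.
move=> f0 g0 e e0; have e20 : 0 < e / 2 by rewrite divr_gt0.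
have [N hN] := f0 _ e20; have [M hM] := g0 _ e20.
exists (maxn N M) => n; rewrite geq_max => /andP[/hN h1 /hM h2]; lra.
Qed.

Lemma null_scale c f : 0 <= c -> null f -> null (fun n => c * f n).
Proof.
move=> c0 f0 e e0; have c1 : 0 < c + 1 by lra.
have [N hN] := f0 _ (divr_gt0 e0 c1); exists N => n /hN.
rewrite ltr_pdivlMr // => h; have [fn|fn] := lerP 0 (f n); first nra.
have : c * f n <= 0 by rewrite mulr_ge0_le0 // ltW.
lra.
Qed.

Definition cvgC (z : nat -> C) (l : C) := null (fun n => cabs (z n - l)).

Lemma cvgC_cst l : cvgC (fun _ => l) l.
Proof. by move=> e e0; exists 0%N => n _; rewrite subrr cabs0. Qed.

Lemma cvgC_lin a z w l m : cvgC z l -> cvgC w m -> cvgC (fun n => a * z n + w n) (a * l + m).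
Proof.
move=> zl wm; apply: null_le (null_add (null_scale (cabs_ge0 a) zl) wm) => n.
by rewrite opprD addrACA -mulrBr -cabsM cabsD.
Qed.

Lemma cvgC_conj z l : cvgC z l -> cvgC (fun n => (z n)^*%C) l^*%C.
Proof. by apply: null_le => n; rewrite -rmorphB cabsJ. Qed.

Lemma cvgC_close z w l : cvgC z l -> null (fun n => cabs (z n - w n)) -> cvgC w l.
Proof.
move=> zl zw; apply: null_le (null_add zw zl) => n.
by rewrite -(cabsN (z n - w n)) opprB; apply: le_trans (cabsD _ _); rewrite addrA subrK.
Qed.

Lemma null_cst c : null (fun _ => c) -> c <= 0.
Proof.
by move=> h; rewrite leNgt; apply/negP => c0; have [N /(_ N (leqnn _))] := h _ c0; rewrite ltxx.
Qed.

Lemma cvgC_uniq z l m : cvgC z l -> cvgC z m -> l = m.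
Proof.
move=> zl zm; apply/eqP; rewrite -subr_eq0; apply/eqP/cabs_le0/null_cst.
apply: null_le (null_add zl zm) => n.
by rewrite -(cabsN (z n - l)) opprB; apply: le_trans (cabsD _ _); rewrite addrA subrK.
Qed.

Lemma cvgC_ge0 z l : (forall n, 0 <= z n) -> cvgC z l -> 0 <= l.
Proof.
move=> z0 zl; rewrite lecE /=; apply/andP; split.
  rewrite -normr_le0; apply: null_cst; apply: null_le zl => n.
  have := Im_le_cabs (z n - l); rewrite raddfB /= (ger0_Im (z0 n)) sub0r normrN.
  by [].
rewrite -subr_le0 sub0r; apply: null_cst; apply: null_le zl => n.
have := Re_le_cabs (z n - l); rewrite raddfB /=; apply: le_trans.
have := z0 n; rewrite lecE /= => /andP[_ h]; have := ler_norm (Re (z n) - Re l); lra.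
Qed.

(** The limit is the lower limit, taken as the supremum of the eventual lower bounds. *)
Lemma cauchyR (a : nat -> R) :
  (forall e, 0 < e -> exists N, forall m n, (N <= m)%N -> (N <= n)%N -> `|a m - a n| < e) ->
  exists l, null (fun n => `|a n - l|).
Proof.
move=> ca; pose A := [set x | exists N, forall n, (N <= n)%N -> x <= a n]%classic.
have ub N x e : (forall m n, (N <= m)%N -> (N <= n)%N -> `|a m - a n| < e) -> A x -> x <= a N + e.
  move=> hN [M hM]; have h1 := hM _ (leq_maxr N M).
  by have := hN _ _ (leq_maxl N M) (leqnn N); rewrite ltr_norml => /andP[_ h2]; lra.
have lb N e : (forall m n, (N <= m)%N -> (N <= n)%N -> `|a m - a n| < e) -> A (a N - e).
  move=> hN; exists N => n Nn; have := hN _ _ (leqnn N) Nn.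
  by rewrite ltr_norml => /andP[_ h2]; lra.
have supA : has_sup A.
  have [N hN] := ca _ ltr01; split; first by exists (a N - 1); exact: lb.
  by exists (a N + 1) => x; exact: ub.
exists (sup A) => e e0; have [N hN] := ca _ (divr_gt0 e0 (ltr0n _ 3)).
exists N => n Nn; have := hN _ _ Nn (leqnn N).
have h1 : a N - e / 3 <= sup A by apply: sup_upper_bound => //; exact: lb.
have h2 : sup A <= a N + e / 3 by apply: ge_sup; [exact: supA.1|move=> x; exact: ub].
by rewrite !ltr_norml => /andP[h3 h4]; apply/andP; split; lra.
Qed.

Lemma cauchyC (z : nat -> C) :
  (forall e, 0 < e -> exists N, forall m n, (N <= m)%N -> (N <= n)%N -> cabs (z m - z n) < e) ->
  exists l, cvgC z l.
Proof.
move=> cz.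
have [a ha] : exists a, null (fun n => `|Re (z n) - a|).
  apply: cauchyR => e /cz[N hN]; exists N => m n hm hn.
  by apply: le_lt_trans (hN m n hm hn); rewrite -raddfB Re_le_cabs.
have [b hb] : exists b, null (fun n => `|Im (z n) - b|).
  apply: cauchyR => e /cz[N hN]; exists N => m n hm hn.
  by apply: le_lt_trans (hN m n hm hn); rewrite -raddfB Im_le_cabs.
exists (a +i* b); apply: null_le (null_add ha hb) => n.
by apply: le_trans (cabs_le_ReIm _) _; case: (z n).
Qed.

Lemma null_sqrt (f : nat -> R) : (forall n, 0 <= f n) -> null (fun n => f n ^+ 2) -> null f.
Proof.
move=> f0 h e e0; have [N hN] := h _ (exprn_gt0 2 e0).
by exists N => n /hN; rewrite ltr_pXn2r ?nnegrE // ltW.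
Qed.

Lemma cvgC_Re_le (z : nat -> C) l c N :
  (forall n, (N <= n)%N -> Re (z n) <= c) -> cvgC z l -> Re l <= c.
Proof.
move=> zc zl; rewrite leNgt; apply/negP => cl.
have [M /(_ (maxn N M) (leq_maxr _ _))] : exists M, forall n, (M <= n)%N -> cabs (z n - l) < Re l
  - c.
  by apply: zl; rewrite subr_gt0.
have := zc _ (leq_maxl N M); have := Re_le_cabs (z (maxn N M) - l); rewrite raddfB /=.
rewrite distrC; have := ler_norm (Re l - Re (z (maxn N M))); lra.
Qed.

End Limits.

Section SemiInner.
Variables (R : realType) (E : Type).
Local Notation C := R[i].
Local Notation Re := (complex.Re (R:=R)).
Variables (add : E -> E -> E) (scl : C -> E -> E) (F : E -> E -> C).
Hypothesis F_addl : forall s s' t, F (add s s') t = F s t + F s' t.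
Hypothesis F_scll : forall a s t, F (scl a s) t = a * F s t.
Hypothesis F_herm : forall s t, F t s = (F s t)^*%C.
Hypothesis F_ge0 : forall s, 0 <= F s s.

Definition snorm s : R := Num.sqrt (Re (F s s)).
(** No vector space laws are assumed on [E], which will be lists under concatenation. Identities
    between vectors are therefore verified only after expanding [F]. *)
Definition sub s t := add s (scl (-1) t).

Lemma F_addr s t t' : F s (add t t') = F s t + F s t'.
Proof. by rewrite F_herm F_addl rmorphD /= -!F_herm. Qed.

Lemma F_sclr a s t : F s (scl a t) = a^*%C * F s t.
Proof. by rewrite F_herm F_scll rmorphM /= -F_herm. Qed.

Lemma F_subl s s' t : F (sub s s') t = F s t - F s' t.
Proof. by rewrite F_addl F_scll mulN1r. Qed.

Lemma F_subr s t t' : F s (sub t t') = F s t - F s t'.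
Proof. by rewrite F_addr F_sclr rmorphN1 mulN1r. Qed.

Lemma snorm_ge0 s : 0 <= snorm s.
Proof. exact: sqrtr_ge0. Qed.

Lemma snorm_sqr s : (snorm s ^+ 2)%:C = F s s.
Proof.
have := F_ge0 s; rewrite lecE /= => /andP[/eqP h0 h1].
by rewrite sqr_sqrtr //; case: (F s s) h0 => a b /= ->.
Qed.

Lemma snorm_sqrE s : snorm s ^+ 2 = Re (F s s).
Proof. by rewrite -snorm_sqr. Qed.

Lemma snormS a s : snorm (scl a s) = cabs a * snorm s.
Proof.
apply/eqP; rewrite -(eqrXn2 (_ : 0 < 2)%N) ?mulr_ge0 ?snorm_ge0 ?cabs_ge0 //; apply/eqP.
rewrite exprMn !snorm_sqrE F_scll F_sclr mulrA mulJ_cabs.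
by case: (F s s) => x y /=; rewrite !mul0r subr0.
Qed.

Lemma cauchy_schwarz s t : cabs (F s t) <= snorm s * snorm t.
Proof.
rewrite -(ler_pXn2r (_ : 0 < 2)%N) ?nnegrE ?mulr_ge0 ?snorm_ge0 ?cabs_ge0 //.
rewrite exprMn !snorm_sqrE; set A := Re (F s s); set B := Re (F t t); set Z := cabs _ ^+ 2.
(* Positivity of [F] at s + c t with c = - x F(s,t): the phase of F(s,t) cancels, leaving a real
   quadratic in [x], minimal at 1/B when B > 0. *)
have key (x : R) : 0 <= A - 2 * x * Z + x ^+ 2 * Z * B.
  pose c := - (x%:C * F s t).
  have := F_ge0 (add s (scl c t)).
  rewrite F_addl !F_addr !F_scll !F_sclr (F_herm s t) (conjNreal (erefl c)) -!snorm_sqr => h.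
  have {h} : 0 <= (A - 2 * x * Z + x ^+ 2 * Z * B)%:C.
    move: h; congr (0 <= _); rewrite /A /B /c -!snorm_sqrE /Z; move: (mulJ_cabs (F s t)).
    by rewrite !(rmorphD, rmorphB, rmorphM, rmorphN) /= => e; ring: e.
  by rewrite lecE /= => /andP[].
have Z0 : 0 <= Z by rewrite sqr_ge0.
have B0 : 0 <= B by rewrite /B -snorm_sqrE sqr_ge0.
have A0 : 0 <= A by rewrite /A -snorm_sqrE sqr_ge0.
have [B1|B1] := ltrP 0 B.
  have := key B^-1; have -> : B^-1 ^+ 2 * Z * B = B^-1 * Z by field; rewrite gt_eqF.
  have -> : A - 2 * B^-1 * Z + B^-1 * Z = A - Z / B by ring.
  by rewrite subr_ge0 ler_pdivrMr.
have -> : B = 0 by lra.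
rewrite mulr0; have [Z1|//] := ltrP 0 Z.
(* With B = 0 the quadratic is affine in [x], and this [x] gives it the value A - (A + 1) = -1,
   which excludes Z > 0. *)
have := key ((A + 1) / (2 * Z)); have -> : B = 0 by lra.
rewrite mulr0 addr0.
have -> : 2 * ((A + 1) / (2 * Z)) * Z = A + 1 by field; rewrite gt_eqF.
lra.
Qed.

Lemma snormD s t : snorm (add s t) <= snorm s + snorm t.
Proof.
rewrite -(ler_pXn2r (_ : 0 < 2)%N) ?nnegrE ?addr_ge0 ?snorm_ge0 //.
rewrite snorm_sqrE F_addl !F_addr (F_herm s t) !raddfD /= -!snorm_sqrE.
have := cauchy_schwarz s t; have := Re_le_cabs (F s t); have := ler_norm (Re (F s t)).
have -> : Re (F s t)^*%C = Re (F s t) by case: (F s t).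
rewrite sqrrD => h1 h2 h3; rewrite mulr2n; lra.
Qed.

Lemma snorm_sub_le s t r : snorm (sub s r) <= snorm (sub s t) + snorm (sub t r).
Proof.
have -> : snorm (sub s r) = snorm (add (sub s t) (sub t r)).
  by rewrite /snorm !(F_addl, F_addr, F_subl, F_subr); congr (Num.sqrt (Re _)); ring.
exact: snormD.
Qed.

Lemma snorm_subC s t : snorm (sub s t) = snorm (sub t s).
Proof. by rewrite /snorm !(F_subl, F_subr); congr (Num.sqrt (Re _)); ring. Qed.

Lemma snorm_le_sub s t : snorm s <= snorm (sub s t) + snorm t.
Proof.
have -> : snorm s = snorm (add (sub s t) t).
  by rewrite /snorm !(F_addl, F_addr, F_subl, F_subr); congr (Num.sqrt (Re _)); ring.
exact: snormD.
Qed.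

Definition cauchy_seq (u : nat -> E) := forall e, 0 < e ->
  exists N, forall m n, (N <= m)%N -> (N <= n)%N -> snorm (sub (u m) (u n)) < e.

Lemma cauchy_seq_bounded u : cauchy_seq u -> exists M N, 0 < M /\ forall n, (N <= n)%N -> snorm
  (u n) <= M.
Proof.
move=> /(_ _ ltr01)[N hN]; exists (1 + snorm (u N)), N; split.
  by rewrite ltr_wpDr ?snorm_ge0.
move=> n Nn; apply: le_trans (snorm_le_sub _ (u N)) _.
by rewrite lerD2r ltW // hN.
Qed.

Lemma F_diff s t s' t' :
  cabs (F s t - F s' t') <= snorm (sub s s') * snorm t + snorm s' * snorm (sub t t').
Proof.
have -> : F s t - F s' t' = F (sub s s') t + F s' (sub t t').
  by rewrite F_subl F_subr; ring.
by apply: le_trans (cabsD _ _) _; apply: lerD; apply: cauchy_schwarz.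
Qed.

Lemma F_cauchy u v : cauchy_seq u -> cauchy_seq v -> exists l, cvgC (fun n => F (u n) (v n)) l.
Proof.
move=> cu cv; apply: cauchyC => e e0.
have [M [N [M0 hM]]] := cauchy_seq_bounded cu; have [M' [N' [M0' hM']]] := cauchy_seq_bounded cv.
have [K hK] := cu _ (divr_gt0 e0 (mulr_gt0 (ltr0n _ 2) M0')).
have [K' hK'] := cv _ (divr_gt0 e0 (mulr_gt0 (ltr0n _ 2) M0)).
exists (N + N' + K + K')%N => m n hm hn.
have h1 : snorm (sub (u m) (u n)) < e / (2 * M') by apply: hK; lia.
have h2 : snorm (sub (v m) (v n)) < e / (2 * M) by apply: hK'; lia.
have h3 : snorm (v m) <= M' by apply: hM'; lia.
have h4 : snorm (u n) <= M by apply: hM; lia.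
apply: le_lt_trans (F_diff _ _ _ _) _.
rewrite ltr_pdivlMr ?mulr_gt0 // in h1; rewrite ltr_pdivlMr ?mulr_gt0 // in h2.
have := snorm_ge0 (sub (u m) (u n)); have := snorm_ge0 (sub (v m) (v n)).
have := snorm_ge0 (v m); have := snorm_ge0 (u n).
nra.
Qed.

Lemma F_close u v u' v' : cauchy_seq u' -> cauchy_seq v ->
  null (fun n => snorm (sub (u n) (u' n))) -> null (fun n => snorm (sub (v n) (v' n))) ->
  null (fun n => cabs (F (u n) (v n) - F (u' n) (v' n))).
Proof.
move=> cu cv uu vv e e0.
have [M [N [M0 hM]]] := cauchy_seq_bounded cu; have [M' [N' [M0' hM']]] := cauchy_seq_bounded cv.
have [K hK] := uu _ (divr_gt0 e0 (mulr_gt0 (ltr0n _ 2) M0')).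
have [K' hK'] := vv _ (divr_gt0 e0 (mulr_gt0 (ltr0n _ 2) M0)).
exists (N + N' + K + K')%N => n hn.
have h1 : snorm (sub (u n) (u' n)) < e / (2 * M') by apply: hK; lia.
have h2 : snorm (sub (v n) (v' n)) < e / (2 * M) by apply: hK'; lia.
have h3 : snorm (v n) <= M' by apply: hM'; lia.
have h4 : snorm (u' n) <= M by apply: hM; lia.
apply: le_lt_trans (F_diff _ _ _ _) _.
rewrite ltr_pdivlMr ?mulr_gt0 // in h1; rewrite ltr_pdivlMr ?mulr_gt0 // in h2.
have := snorm_ge0 (sub (u n) (u' n)); have := snorm_ge0 (sub (v n) (v' n)).
have := snorm_ge0 (v n); have := snorm_ge0 (u' n).
nra.
Qed.

End SemiInner.

(** * Kolmogorov decomposition of a positive definite kernel *)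

Lemma lt_of_thirds (R : realFieldType) (e a b c x y : R) :
  a < e / 3 -> b < e / 3 -> c < e / 3 -> x <= b + y -> y <= a + c -> x < e.
Proof. lra. Qed.

Section Combinations.
Variables (R : realType) (X : Type).
Local Notation C := R[i].
Local Notation Re := (complex.Re (R:=R)).
Local Notation E := (seq (C * X)).
Variable k : X -> X -> C.
Hypothesis k_psd : psd k.
Hypothesis k_herm : forall x y, k y x = (k x y)^*%C.

Definition comb_ip (s t : E) : C := \sum_(p <- s) \sum_(r <- t) p.1 * r.1^*%C * k p.2 r.2.
Definition comb_scale (a : C) (s : E) : E := [seq (a * p.1, p.2) | p <- s].

Lemma comb_ip_addl s s' t : comb_ip (s ++ s') t = comb_ip s t + comb_ip s' t.
Proof. exact: big_cat. Qed.

Lemma comb_ip_scll a s t : comb_ip (comb_scale a s) t = a * comb_ip s t.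
Proof.
rewrite /comb_ip big_map mulr_sumr; apply: eq_bigr => p _.
by rewrite mulr_sumr; apply: eq_bigr => r _ /=; rewrite !mulrA.
Qed.

Lemma comb_ip_herm s t : comb_ip t s = (comb_ip s t)^*%C.
Proof.
rewrite /comb_ip exchange_big [RHS]rmorph_sum /=; apply: eq_bigr => p _.
rewrite [RHS]rmorph_sum /=; apply: eq_bigr => r _.
by rewrite k_herm !rmorphM /= conjcK; ring.
Qed.

Lemma comb_ip_ge0 s : 0 <= comb_ip s s.
Proof. exact: k_psd. Qed.

Local Notation nrm := (snorm comb_ip).
Local Notation csub := (sub cat comb_scale).
Local Notation comb_cauchy := (cauchy_seq cat comb_scale comb_ip).

Definition comb1 (x : X) : E := [:: (1, x)].

(** A point of the completion is encoded as the function of its inner products with the points of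
    [X], as in a reproducing kernel space. Equivalent Cauchy sequences give the same function, so no
    quotient is formed. *)
Definition limit_of (u : nat -> E) (phi : X -> C) :=
  comb_cauchy u /\ forall x, cvgC (fun n => comb_ip (u n) (comb1 x)) (phi x).

Lemma comb_ip_consr s r t : comb_ip s (r :: t) = r.1^*%C * comb_ip s (comb1 r.2) + comb_ip s t.
Proof.
rewrite comb_ip_herm -cat1s comb_ip_addl rmorphD /= -!comb_ip_herm; congr (_ + _).
rewrite /comb_ip mulr_sumr; apply: eq_bigr => p _.
by rewrite /comb1 !big_seq1 [X in _ * (_ * X * _)](conjc1 R) mulr1 mulrCA !mulrA.
Qed.

Lemma comb_cauchy_lin a u v : comb_cauchy u -> comb_cauchy v -> comb_cauchy (fun n => comb_scale
  a (u n) ++ v n).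
Proof.
move=> cu cv e e0.
have [N hN] := cu _ (divr_gt0 e0 (mulr_gt0 (ltr0n _ 2) (ltr_wpDl (cabs_ge0 a) ltr01))).
have [M hM] := cv _ (divr_gt0 e0 (ltr0n _ 2)).
exists (N + M)%N => m n hm hn.
have h1 : nrm (csub (u m) (u n)) < e / (2 * (cabs a + 1)) by apply: hN; lia.
have h2 : nrm (csub (v m) (v n)) < e / 2 by apply: hM; lia.
have -> : nrm (csub (comb_scale a (u m) ++ v m) (comb_scale a (u n) ++ v n)) =
          nrm (comb_scale a (csub (u m) (u n)) ++ csub (v m) (v n)).
  rewrite /snorm !(F_subl comb_ip_addl comb_ip_scll, F_subr comb_ip_addl comb_ip_scll comb_ip_herm,
    comb_ip_addl, comb_ip_scll, F_addr comb_ip_addl comb_ip_herm, F_sclr comb_ip_scll comb_ip_herm).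
  by congr (Num.sqrt (Re _)); ring.
apply: le_lt_trans (snormD comb_ip_addl comb_ip_scll comb_ip_herm comb_ip_ge0 _ _) _.
rewrite (snormS comb_ip_scll comb_ip_herm comb_ip_ge0).
have a0 := cabs_ge0 a; rewrite ltr_pdivlMr in h1; last by rewrite mulr_gt0 // ltr_wpDl.
have := snorm_ge0 comb_ip (csub (u m) (u n)); nra.
Qed.

Lemma limit_lin a u v phi psi : limit_of u phi -> limit_of v psi ->
  limit_of (fun n => comb_scale a (u n) ++ v n) (a *: phi + psi).
Proof.
move=> [cu hu] [cv hv]; split; first exact: comb_cauchy_lin.
move=> x; rewrite (_ : (fun n => _) =
  fun n => a * comb_ip (u n) (comb1 x) + comb_ip (v n) (comb1 x)); first exact: cvgC_lin.
by apply/funext => n; rewrite comb_ip_addl comb_ip_scll.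
Qed.

Lemma limit_comb u phi t : limit_of u phi ->
  cvgC (fun n => comb_ip (u n) t) (\sum_(r <- t) r.1^*%C * phi r.2).
Proof.
move=> [cu hu]; elim: t => [|r t IH].
  rewrite big_nil (_ : (fun n => _) = fun n => 0); first exact: cvgC_cst.
  by apply/funext => n; rewrite comb_ip_herm /comb_ip big_nil conjc0.
rewrite big_cons (_ : (fun n => _) =
  fun n => r.1^*%C * comb_ip (u n) (comb1 r.2) + comb_ip (u n) t); first exact: cvgC_lin.
by apply/funext => n; rewrite comb_ip_consr.
Qed.

(* A Cauchy sequence that tends weakly to 0 tends to 0 in norm: compare u n with a fixed late
  term. *)
Lemma limit_null u : limit_of u 0 -> null (fun n => nrm (u n)).
Proof.
move=> ul; have [cu _] := ul; apply: null_sqrt => [n|e e0]; first exact: snorm_ge0.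
have [M [N0 [M0 hM]]] := cauchy_seq_bounded comb_ip_addl comb_ip_scll comb_ip_herm comb_ip_ge0 cu.
have [N hN] := cu _ (divr_gt0 e0 (mulr_gt0 (ltr0n _ 2) M0)).
have := limit_comb (u N) ul; rewrite big1 => [|r _]; last by rewrite mulr0.
move=> /(_ _ (divr_gt0 e0 (ltr0n _ 2)))[N' hN'].
exists (N0 + N + N')%N => n hn.
have h1 : nrm (u n) <= M by apply: hM; lia.
have h2 : nrm (csub (u n) (u N)) < e / (2 * M) by apply: hN; lia.
have h3 : cabs (comb_ip (u n) (u N)) < e / 2 by rewrite -[comb_ip _ _]subr0; apply: hN'; lia.
rewrite (snorm_sqrE comb_ip_ge0).
have -> : comb_ip (u n) (u n) = comb_ip (u n) (u N) + comb_ip (u n) (csub (u n) (u N)).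
  by rewrite (F_subr comb_ip_addl comb_ip_scll comb_ip_herm) addrC subrK.
apply: le_lt_trans (ler_norm _) _; apply: le_lt_trans (Re_le_cabs _) _.
apply: le_lt_trans (cabsD _ _) _.
have h4 := cauchy_schwarz comb_ip_addl comb_ip_scll comb_ip_herm comb_ip_ge0 (u n) (csub (u n) (u
  N)).
rewrite ltr_pdivlMr ?mulr_gt0 // in h2.
have := snorm_ge0 comb_ip (u n); have := snorm_ge0 comb_ip (csub (u n) (u N)); nra.
Qed.

Lemma limit_close u v phi : limit_of u phi -> limit_of v phi -> null (fun n => nrm (csub (u n) (v
  n))).
Proof.
move=> ul vl; have := limit_lin (-1) ul vl; rewrite scaleN1r addNr => /limit_null.
apply: null_le => n; rewrite /snorm.
rewrite !(F_subl comb_ip_addl comb_ip_scll, F_subr comb_ip_addl comb_ip_scll comb_ip_herm,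
    comb_ip_addl, comb_ip_scll, F_addr comb_ip_addl comb_ip_herm, F_sclr comb_ip_scll comb_ip_herm).
by rewrite le_eqVlt; apply/orP; left; apply/eqP; congr (Num.sqrt (Re _)); rewrite rmorphN1; ring.
Qed.

Lemma limit_cst s : limit_of (fun _ => s) (fun x => comb_ip s (comb1 x)).
Proof.
split=> [e e0|x]; last exact: cvgC_cst.
exists 0%N => m n _ _; rewrite /snorm !(F_subl comb_ip_addl comb_ip_scll) subrr.
by rewrite sqrtr0.
Qed.

Definition completion_pred : {pred (X -> C)} := fun phi => `[< exists u, limit_of u phi >].

Lemma completion_submod : submod_closed completion_pred.
Proof.
split; first apply/asboolP.
  exists (fun _ => [::]); have := limit_cst [::]; congr (limit_of _ _).
  by apply/funext => x; rewrite /comb_ip big_nil.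
move=> a phi psi /asboolP[u hu] /asboolP[v hv]; apply/asboolP.
by eexists; apply: limit_lin; eassumption.
Qed.

HB.instance Definition _ := GRing.isSubmodClosed.Build C (X -> C) completion_pred completion_submod.

Definition completion := {phi : X -> C | completion_pred phi}.
HB.instance Definition _ := SubType.on completion.
HB.instance Definition _ := Choice.on completion.
HB.instance Definition _ := [SubChoice_isSubLmodule of completion by <:].

Local Notation K := completion.

Definition repr_seq (phi : K) : nat -> E :=
  projT1 (cid (asboolW (svalP phi))).

Lemma repr_seqP (phi : K) : limit_of (repr_seq phi) (val phi).
Proof. exact: projT2 (cid (asboolW (svalP phi))). Qed.

Definition completion_ip (phi psi : K) : C :=
  projT1 (cid (F_cauchy comb_ip_addl comb_ip_scll comb_ip_herm comb_ip_ge0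
    (proj1 (repr_seqP phi)) (proj1 (repr_seqP psi)))).

Lemma completion_ip_lim u v (phi psi : K) : limit_of u (val phi) -> limit_of v (val psi) ->
  cvgC (fun n => comb_ip (u n) (v n)) (completion_ip phi psi).
Proof.
move=> ul vl; apply: cvgC_close (projT2 (cid (F_cauchy comb_ip_addl comb_ip_scll comb_ip_herm
  comb_ip_ge0 (proj1 (repr_seqP phi)) (proj1 (repr_seqP psi))))) _.
apply: (F_close comb_ip_addl comb_ip_scll comb_ip_herm comb_ip_ge0 (proj1 ul) (proj1 (repr_seqP
  psi))).
  exact: limit_close (repr_seqP phi) ul.
exact: limit_close (repr_seqP psi) vl.
Qed.

Lemma completion_ip_linl a (x y z : K) :
  completion_ip (a *: x + y) z = a * completion_ip x z + completion_ip y z.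
Proof.
apply: cvgC_uniq (cvgC_lin a (completion_ip_lim (repr_seqP x) (repr_seqP z))
   (completion_ip_lim (repr_seqP y) (repr_seqP z))).
rewrite (_ : (fun n => _) = fun n =>
  comb_ip (comb_scale a (repr_seq x n) ++ repr_seq y n) (repr_seq z n)); last first.
  by apply/funext => n; rewrite comb_ip_addl comb_ip_scll.
apply: completion_ip_lim (repr_seqP z).
exact: limit_lin (repr_seqP x) (repr_seqP y).
Qed.

Lemma completion_ip_conj (x y : K) : completion_ip y x = (completion_ip x y)^*%C.
Proof.
apply: cvgC_uniq (completion_ip_lim (repr_seqP y) (repr_seqP x)) _.
rewrite (_ : (fun n => _) = fun n => (comb_ip (repr_seq x n) (repr_seq y n))^*%C).
  exact: cvgC_conj (completion_ip_lim (repr_seqP x) (repr_seqP y)).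
by apply/funext => n; rewrite comb_ip_herm.
Qed.

Lemma completion_ip_ge0 (x : K) : 0 <= completion_ip x x.
Proof.
by apply: cvgC_ge0 (completion_ip_lim (repr_seqP x) (repr_seqP x)) => n; exact: comb_ip_ge0.
Qed.

(** If the square norm vanishes, a representing sequence tends to 0 in norm; by Cauchy-Schwarz its
    inner products with all points of [X] tend to 0, so the function itself is 0. *)
Lemma completion_ip_posdef (x : K) : x != 0 -> 0 < completion_ip x x.
Proof.
move=> x0; rewrite lt_neqAle completion_ip_ge0 andbT; apply: contra x0 => /eqP ip0.
have ul := repr_seqP x.
have n0 : null (fun n => nrm (repr_seq x n)).
  apply: null_sqrt => [n|]; first exact: snorm_ge0.
  have := completion_ip_lim ul ul; rewrite -ip0; apply: null_le => n.
  rewrite (snorm_sqrE comb_ip_ge0) subr0; apply: le_trans (ler_norm _) (Re_le_cabs _).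
apply/eqP/val_inj/funext => y; have [_ /(_ y) hy] := ul.
apply: cvgC_uniq hy _.
apply: null_le (null_scale (snorm_ge0 comb_ip (comb1 y)) n0) => n.
rewrite subr0 mulrC.
exact: (cauchy_schwarz comb_ip_addl comb_ip_scll comb_ip_herm comb_ip_ge0).
Qed.

Lemma mem_completion u phi : limit_of u phi -> completion_pred phi.
Proof. by move=> h; apply/asboolP; exists u. Qed.

Definition comb_emb (s : E) : K := exist (fun phi => is_true (completion_pred phi)) _
  (mem_completion (limit_cst s)).

Lemma comb_emb_ip s t : completion_ip (comb_emb s) (comb_emb t) = comb_ip s t.
Proof.
apply: cvgC_uniq (completion_ip_lim (limit_cst s : limit_of _ (val (comb_emb s)))
  (limit_cst t : limit_of _ (val (comb_emb t)))) _; exact: cvgC_cst.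
Qed.

Lemma comb_emb_lin a s t : comb_emb (comb_scale a s ++ t) = a *: comb_emb s + comb_emb t.
Proof. by apply/val_inj/funext => x; rewrite /= comb_ip_addl comb_ip_scll. Qed.

Local Notation knorm := (snorm completion_ip).

Lemma completion_ip_addl (x y z : K) : completion_ip (x + y) z = completion_ip x z +
  completion_ip y z.
Proof. by rewrite -[x]scale1r completion_ip_linl mul1r scale1r. Qed.

Lemma completion_ip_0l (z : K) : completion_ip 0 z = 0.
Proof.
have := completion_ip_addl 0 0 z; rewrite addr0 => /eqP.
by rewrite -subr_eq0 opprD addrA subrr sub0r oppr_eq0 => /eqP.
Qed.

Lemma completion_ip_scll a (x z : K) : completion_ip (a *: x) z = a * completion_ip x z.
Proof. by rewrite -[a *: x]addr0 completion_ip_linl completion_ip_0l addr0. Qed.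

Lemma sub_completion (x y : K) : sub +%R *:%R x y = x - y.
Proof. by rewrite /sub scaleN1r. Qed.

Lemma limit_dense u (phi : K) : limit_of u (val phi) -> null (fun n => knorm (phi - comb_emb (u
  n))).
Proof.
move=> ul e e0; have e20 := divr_gt0 e0 (ltr0n R 2); have [N hN] := proj1 ul _ e20.
(* The squared distance is the limit of the squared norms of the differences of [u n] and [u m].
   Limits keep only weak inequalities, hence the margin [e / 2]. *)
exists N => m hm; apply: (@le_lt_trans _ _ (e / 2)); last lra.
rewrite -(ler_pXn2r (_ : 0 < 2)%N) ?nnegrE ?snorm_ge0 ?(ltW e20) // (snorm_sqrE completion_ip_ge0).
have lim : limit_of (fun n => comb_scale (-1) (u m) ++ u n) (val (phi - comb_emb (u m))).
  have -> : phi - comb_emb (u m) = -1 *: comb_emb (u m) + phi by rewrite scaleN1r addrC.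
  exact: (limit_lin (-1) (limit_cst (u m)) ul).
apply: cvgC_Re_le (completion_ip_lim lim lim) => n hn.
have h := ltW (hN n m hn hm).
rewrite -(snorm_sqrE comb_ip_ge0) ler_pXn2r ?nnegrE ?snorm_ge0 ?(ltW e20) //.
apply: le_trans h; rewrite /snorm.
rewrite !(F_subl comb_ip_addl comb_ip_scll, F_subr comb_ip_addl comb_ip_scll comb_ip_herm,
    comb_ip_addl, comb_ip_scll, F_addr comb_ip_addl comb_ip_herm, F_sclr comb_ip_scll comb_ip_herm).
by rewrite le_eqVlt; apply/orP; left; apply/eqP; congr (Num.sqrt (Re _)); rewrite rmorphN1; ring.
Qed.

Lemma comb_emb_norm s t : nrm (csub s t) = knorm (comb_emb s - comb_emb t).
Proof.
rewrite -sub_completion /snorm.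
rewrite !(F_subl comb_ip_addl comb_ip_scll, F_subr comb_ip_addl comb_ip_scll comb_ip_herm).
rewrite !(F_subl completion_ip_addl completion_ip_scll,
  F_subr completion_ip_addl completion_ip_scll completion_ip_conj).
by rewrite !comb_emb_ip.
Qed.

Lemma knorm_triangle (x y z : K) : knorm (x - z) <= knorm (x - y) + knorm (y - z).
Proof.
rewrite -!sub_completion.
exact: (snorm_sub_le completion_ip_addl completion_ip_scll completion_ip_conj completion_ip_ge0).
Qed.

Lemma knormC (x y : K) : knorm (x - y) = knorm (y - x).
Proof.
rewrite -!sub_completion.
exact: (snorm_subC completion_ip_addl completion_ip_scll completion_ip_conj).
Qed.

(** Each [u n] is replaced by a finite combination [s n] at distance below 1/(n+1). The [s n] form a
    Cauchy sequence of combinations, whose weak limit is a point of the completion by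
    construction. *)
Lemma completion_complete (u : nat -> K) :
  (forall e : R, 0 < e -> exists N : nat, forall m n : nat, (N <= m)%N -> (N <= n)%N ->
     knorm (u m - u n) < e) ->
  exists l, null (fun n => knorm (u n - l)).
Proof.
move=> cu.
have inv_gt0 n : 0 < (n.+1%:R : R)^-1 by rewrite invr_gt0 ltr0n.
have approx n : exists s, knorm (u n - comb_emb s) < n.+1%:R^-1.
  by have [N /(_ N (leqnn N))] := limit_dense (repr_seqP (u n)) (inv_gt0 n);
    exists (repr_seq (u n) N).
pose s n := projT1 (cid (approx n)).
have sP n : knorm (u n - comb_emb (s n)) < n.+1%:R^-1 := projT2 (cid (approx n)).
have small : null (fun n => knorm (u n - comb_emb (s n))).
  move=> e e0; exists (Num.truncn e^-1) => n hn; apply: lt_trans (sP n) _.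
  rewrite invf_plt ?posrE ?ltr0n //; apply: lt_le_trans (truncnS_gt _) _.
  by rewrite ler_nat.
have cs : comb_cauchy s.
  move=> e e0; have e3 := divr_gt0 e0 (ltr0n R 3).
  have [N hN] := cu _ e3; have [M hM] := small _ e3.
  exists (N + M)%N => m n hm hn; rewrite comb_emb_norm.
  have h1 : knorm (u m - u n) < e / 3 by apply: hN; lia.
  have h2 : knorm (u m - comb_emb (s m)) < e / 3 by apply: hM; lia.
  have h3 : knorm (u n - comb_emb (s n)) < e / 3 by apply: hM; lia.
  have h4 := knorm_triangle (comb_emb (s m)) (u m) (comb_emb (s n)).
  have h5 := knorm_triangle (u m) (u n) (comb_emb (s n)).
  by rewrite (knormC (comb_emb (s m)) (u m)) in h4; exact: lt_of_thirds h1 h2 h3 h4 h5.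
have lim x : exists l, cvgC (fun n => comb_ip (s n) (comb1 x)) l.
  apply: (F_cauchy comb_ip_addl comb_ip_scll comb_ip_herm comb_ip_ge0 cs).
  exact: (proj1 (limit_cst (comb1 x))).
pose phi x := projT1 (cid (lim x)).
have sl : limit_of s phi by split=> // x; exact: projT2 (cid (lim x)).
pose l : K := exist (fun phi => is_true (completion_pred phi)) _ (mem_completion sl).
exists l; apply: null_le (null_add small (limit_dense (sl : limit_of s (val l)))) => n.
by rewrite (knormC l (comb_emb (s n))); exact: knorm_triangle.
Qed.

Definition completion_hilbert : hilbert R.
Proof.
apply: (@Hilbert R K completion_ip completion_ip_linl completion_ip_conj completion_ip_posdef).
by move=> u /completion_complete[l hl]; exists l.
Defined.

Lemma comb_emb_sum (s : E) : comb_emb s = \sum_(p <- s) p.1 *: comb_emb (comb1 p.2).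
Proof.
elim: s => [|p s IH].
  by rewrite big_nil; apply/val_inj/funext => x; rewrite /= /comb_ip big_nil.
rewrite big_cons -IH -comb_emb_lin /= mulr1; by case: p.
Qed.

Theorem kolmogorov : exists (K : hilbert R) (e : X -> K),
  (forall x y, ip (e x) (e y) = k x y) /\
  forall phi : K, exists u : nat -> seq (C * X),
    null (fun n => hnorm (phi - \sum_(p <- u n) p.1 *: e p.2)).
Proof.
exists completion_hilbert, (fun x => comb_emb (comb1 x)); split.
  move=> x y; rewrite [LHS]comb_emb_ip /comb_ip !big_seq1.
  by rewrite [X in _ * X * _](conjc1 R) !mul1r.
move=> phi; exists (repr_seq phi); have := limit_dense (repr_seqP phi).
by apply: null_le => n; rewrite comb_emb_sum.
Qed.

End Combinations.

(** * Hilbert spaces and dense families *)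

Section HilbertNorm.
Variables (R : realType) (H : hilbert R).
Local Notation C := R[i].
Local Notation Re := (complex.Re (R:=R)).

Lemma ip_addl (x y z : H) : ip (x + y) z = ip x z + ip y z.
Proof. by rewrite -[x]scale1r ip_linl mul1r scale1r. Qed.

Lemma ip0l (z : H) : ip 0 z = 0.
Proof. by have := ip_sc 0 (0 : H) z; rewrite scale0r mul0r. Qed.

Lemma ip_ge0 (x : H) : 0 <= ip x x.
Proof.
have [->|x0] := eqVneq x 0; last exact/ltW/ip_posdef.
by rewrite ip0l.
Qed.

Lemma hnorm_ge0 (x : H) : 0 <= hnorm x.
Proof. exact: snorm_ge0. Qed.

Lemma hnorm_sqr (x : H) : (hnorm x ^+ 2)%:C = ip x x.
Proof. exact: (snorm_sqr ip_ge0). Qed.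

Lemma hnormD (x y : H) : hnorm (x + y) <= hnorm x + hnorm y.
Proof. exact: (snormD ip_addl (@ip_sc R H) (@ip_conj R H) ip_ge0). Qed.

Lemma hnormZ a (x : H) : hnorm (a *: x) = cabs a * hnorm x.
Proof. exact: (snormS (@ip_sc R H) (@ip_conj R H) ip_ge0). Qed.

Lemma hnormN (x : H) : hnorm (- x) = hnorm x.
Proof. by rewrite -scaleN1r hnormZ cabsN cabs1 mul1r. Qed.

Lemma hnormB (x y : H) : hnorm (x - y) = hnorm (y - x).
Proof. by rewrite -hnormN opprB. Qed.

Lemma hnorm_triangle (x y z : H) : hnorm (x - z) <= hnorm (x - y) + hnorm (y - z).
Proof. by apply: le_trans (hnormD _ _); rewrite addrA subrK. Qed.

Lemma hnorm0 : hnorm (0 : H) = 0.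
Proof. by have := hnormZ 0 (0 : H); rewrite scale0r cabs0 mul0r. Qed.

Lemma hnorm_le0 (x : H) : hnorm x <= 0 -> x = 0.
Proof.
move=> h; apply/eqP/negPn/negP => /(@ip_posdef R H); rewrite -hnorm_sqr.
have -> : hnorm x = 0 by apply/eqP; rewrite eq_le h hnorm_ge0.
by rewrite expr0n ltxx.
Qed.

Lemma ip_cauchy_schwarz (x y : H) : cabs (ip x y) <= hnorm x * hnorm y.
Proof. exact: (cauchy_schwarz ip_addl (@ip_sc R H) (@ip_conj R H) ip_ge0). Qed.

Lemma ip_addr (x y z : H) : ip x (y + z) = ip x y + ip x z.
Proof. exact: (F_addr ip_addl (@ip_conj R H)). Qed.

Lemma ip_scr a (x y : H) : ip x (a *: y) = a^*%C * ip x y.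
Proof. exact: (F_sclr (@ip_sc R H) (@ip_conj R H)). Qed.

Lemma ip_subr (x y z : H) : ip x (y - z) = ip x y - ip x z.
Proof. by rewrite -scaleN1r ip_addr ip_scr rmorphN1 mulN1r. Qed.

Lemma ip_ext (x y : H) : (forall z, ip x z = ip y z) -> x = y.
Proof.
move=> h; apply/eqP; rewrite -subr_eq0; apply/negPn/negP => /(@ip_posdef R H).
by rewrite ip_addl -scaleN1r ip_sc h mulN1r subrr ltxx.
Qed.

Lemma ip_comb (X : Type) (e : X -> H) (s t : seq (C * X)) :
  ip (\sum_(p <- s) p.1 *: e p.2) (\sum_(r <- t) r.1 *: e r.2) =
  comb_ip (fun x y => ip (e x) (e y)) s t.
Proof.
have ip0r z : ip z (0 : H) = 0 by rewrite ip_conj ip0l conjc0.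
elim: s => [|p s IH]; first by rewrite /comb_ip !big_nil ip0l.
rewrite big_cons ip_addl IH /comb_ip [RHS]big_cons; congr (_ + _).
elim: t {IH} => [|r t IH]; first by rewrite !big_nil ip0r.
by rewrite !big_cons ip_addr IH ip_sc ip_scr !mulrA.
Qed.

End HilbertNorm.

(** * Linear maps: polarization and extension from a dense family *)

Section LinearMaps.
Variable R : realType.
Local Notation C := R[i].
Local Notation Re := (complex.Re (R:=R)).

Definition linear_map (H1 H2 : hilbert R) (F : H1 -> H2) :=
  forall a x y, F (a *: x + y) = a *: F x + F y.

Lemma linD (H1 H2 : hilbert R) (F : H1 -> H2) : linear_map F -> forall x y, F (x + y) = F x + F y.
Proof. by move=> FL x y; rewrite -[x in LHS]scale1r FL scale1r. Qed.

Lemma lin0 (H1 H2 : hilbert R) (F : H1 -> H2) : linear_map F -> F 0 = 0.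
Proof. by move=> FL; have := FL (-1) 0 0; rewrite scaler0 addr0 scaleN1r addNr. Qed.

Lemma linZ (H1 H2 : hilbert R) (F : H1 -> H2) : linear_map F -> forall a x, F (a *: x) = a *: F x.
Proof. by move=> FL a x; rewrite -[a *: x]addr0 FL lin0 // addr0. Qed.

Lemma linB (H1 H2 : hilbert R) (F : H1 -> H2) : linear_map F -> forall x y, F (x - y) = F x - F y.
Proof. by move=> FL x y; rewrite -scaleN1r linD // linZ // scaleN1r. Qed.

Lemma lin_sum (H1 H2 : hilbert R) (F : H1 -> H2) (X : Type) (e : X -> H1) (s : seq (C * X)) :
  linear_map F ->
  F (\sum_(p <- s) p.1 *: e p.2) = \sum_(p <- s) p.1 *: F (e p.2).
Proof.
move=> FL; elim: s => [|p s IH]; first by rewrite !big_nil lin0.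
by rewrite !big_cons FL IH.
Qed.

Lemma polarization (H1 H2 : hilbert R) (F : H1 -> H2) : linear_map F ->
  (forall x, hnorm (F x) = hnorm x) -> forall x y, ip (F x) (F y) = ip x y.
Proof.
move=> FL Fi x y.
have sq z : ip (F z) (F z) = ip z z by rewrite -!hnorm_sqr Fi.
(* The first vector yields the sum of the two mixed inner products, the second, after division by i,
   their difference; adding them gives twice the inner product. *)
have h1 := sq (x + y); have h2 := sq ('i%C *: x + y).
rewrite linD // !ip_addl !ip_addr !sq in h1.
rewrite FL !ip_addl !ip_addr !ip_sc !ip_scr !sq in h2.
have {}h1 : ip (F x) (F y) + ip (F y) (F x) = ip x y + ip y x.
  apply: (addrI (ip x x)); apply: (addIr (ip y y)); rewrite !addrA in h1 *; exact: h1.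
have {}h2 : ip (F x) (F y) - ip (F y) (F x) = ip x y - ip y x.
  have i0 : ('i%C : C) != 0 by rewrite eq_complex /= oner_eq0 andbF.
  have iJ : ('i%C)^*%C = - 'i%C :> C by apply/eqP; rewrite eq_complex /= oppr0 !eqxx.
  apply: (mulfI i0); apply: (addrI ('i%C * ('i%C^*%C * ip x x))); apply: (addIr (ip y y)).
  move: h2; rewrite iJ !mulrDr !mulNr !mulrN !addrA => h2.
  by rewrite h2.
have two0 : (2 : C) != 0 by rewrite pnatr_eq0.
apply: (mulfI two0); transitivity ((ip (F x) (F y) + ip (F y) (F x)) + (ip (F x) (F y) - ip (F y)
  (F x))); first by ring.
rewrite h1 h2; ring.
Qed.

Section Dense.
Variables (H1 : hilbert R) (X : Type) (e : X -> H1).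
Local Notation comb f s := (\sum_(p <- s) p.1 *: f p.2).
Hypothesis e_dense : forall phi : H1, exists u : nat -> seq (C * X),
  null (fun n => hnorm (phi - comb e (u n))).

Lemma dense_vanish (g : H1 -> R) (M : R) : 0 <= M ->
  (forall phi s, g phi <= M * hnorm (phi - comb e s)) -> forall phi, g phi <= 0.
Proof.
move=> M0 gM phi; have [u hu] := e_dense phi; apply: null_cst.
by apply: null_le (null_scale M0 hu) => n.
Qed.

Lemma dense_eq (H2 : hilbert R) (F G : H1 -> H2) (M : R) : linear_map F -> linear_map G ->
  (forall x, hnorm (F x) <= M * hnorm x) -> (forall x, hnorm (G x) <= M * hnorm x) ->
  (forall x, F (e x) = G (e x)) -> forall x, F x = G x.
Proof.
move=> FL GL FM GM FG x; apply/eqP; rewrite -subr_eq0; apply/eqP/hnorm_le0.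
have MM y : M * hnorm y <= `|M| * hnorm y by rewrite ler_wpM2r ?hnorm_ge0 ?ler_norm.
apply: (@dense_vanish (fun x => hnorm (F x - G x)) (2 * `|M|)); first by rewrite mulr_ge0.
move=> phi s; set c := comb e s.
have FGc : F c = G c by rewrite (lin_sum _ _ FL) (lin_sum _ _ GL); apply: eq_bigr => p _;
  rewrite FG.
have -> : F phi - G phi = F (phi - c) - G (phi - c) by rewrite (linB FL) (linB GL) FGc opprB
  addrA subrK.
apply: le_trans (hnormD _ _) _; rewrite hnormN.
have := FM (phi - c); have := GM (phi - c); have := MM _ (phi - c); lra.
Qed.

(** The graph [A] consists of limits along approximating sequences. The norm inequality on
    combinations makes it total, by completeness of [H2], and 1-Lipschitz, hence single-valued. *)
Lemma extend_contraction (H2 : hilbert R) (f : X -> H2) :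
  (forall s : seq (C * X), hnorm (comb f s) <= hnorm (comb e s)) ->
  exists F : H1 -> H2, [/\ linear_map F, forall x, hnorm (F x) <= hnorm x & forall x, F (e x) = f
    x].
Proof.
move=> fe.
have combL (H : hilbert R) (g : X -> H) a s t :
    comb g (comb_scale a s ++ t) = a *: comb g s + comb g t.
  rewrite big_cat big_map scaler_sumr; congr (_ + _).
  by apply: eq_bigr => p _; rewrite scalerA.
have combB s t : hnorm (comb f s - comb f t) <= hnorm (comb e s - comb e t).
  have := fe (comb_scale (-1) t ++ s).
  by rewrite !combL !scaleN1r ![- _ + _]addrC.
pose A phi l := exists u : nat -> seq (C * X),
  null (fun n => hnorm (phi - comb e (u n))) /\ null (fun n => hnorm (l - comb f (u n))).
have Atot phi : exists l, A phi l.
  have [u hu] := e_dense phi.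
  have [|l hl] := @ip_complete R H2 (fun n => comb f (u n)).
    move=> d d0; have [N hN] := hu _ (divr_gt0 d0 (ltr0n R 2)); exists N => m n hm hn.
    apply: le_lt_trans (combB _ _) _.
    apply: le_lt_trans (hnorm_triangle _ phi _) _; rewrite hnormB.
    have := hN _ hm; have := hN _ hn; lra.
  exists l, u; split=> // d /hl[N hN]; exists N => n /hN.
  by rewrite -/(hnorm _) hnormB.
have Alip phi l psi m : A phi l -> A psi m -> hnorm (l - m) <= hnorm (phi - psi).
  move=> [u [u1 u2]] [v [v1 v2]]; rewrite -subr_le0; apply: null_cst.
  apply: null_le (null_add (null_add u1 u2) (null_add v1 v2)) => n.
  have h1 := hnorm_triangle l (comb f (u n)) m.
  have h2 := hnorm_triangle (comb f (u n)) (comb f (v n)) m.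
  have h3 := combB (u n) (v n).
  have h4 := hnorm_triangle (comb e (u n)) phi (comb e (v n)).
  have h5 := hnorm_triangle phi psi (comb e (v n)).
  rewrite (hnormB (comb f (v n)) m) in h2; rewrite (hnormB (comb e (u n)) phi) in h4; lra.
pose F phi := projT1 (cid (Atot phi)).
have FA phi : A phi (F phi) := projT2 (cid (Atot phi)).
have FE phi l : A phi l -> F phi = l.
  move=> Al; apply/eqP; rewrite -subr_eq0; apply/eqP/hnorm_le0.
  by apply: le_trans (Alip _ _ _ _ (FA phi) Al) _; rewrite subrr hnorm0.
exists F; split.
- move=> a x y; apply: FE; have [u [u1 u2]] := FA x; have [v [v1 v2]] := FA y.
  exists (fun n => comb_scale a (u n) ++ v n); split.
    apply: null_le (null_add (null_scale (cabs_ge0 a) u1) v1) => n.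
    by rewrite combL opprD addrACA -scalerBr -hnormZ hnormD.
  apply: null_le (null_add (null_scale (cabs_ge0 a) u2) v2) => n.
  by rewrite combL opprD addrACA -scalerBr -hnormZ hnormD.
- move=> x; have A0 : A 0 0.
    exists (fun _ => [::]); rewrite !big_nil !subr0 !hnorm0.
    by split=> d d0; exists 0%N.
  by have := Alip _ _ _ _ (FA x) A0; rewrite !subr0.
- move=> x; apply: FE; exists (fun _ => [:: (1, x)]).
  rewrite !big_seq1 !scale1r !subrr !hnorm0.
  by split=> d d0; exists 0%N.
Qed.

End Dense.
End LinearMaps.

(** * Reordering products of unitaries *)

Lemma uniq_NoDup (A : eqType) (s : seq A) : reflect (List.NoDup s) (uniq s).
Proof.
elim: s => [|a s IH] /=; first by apply: ReflectT; constructor.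
have inP (t : seq A) : a \in t <-> List.In a t.
  elim: t => //= b t <-; rewrite inE; split=> [/orP[/eqP ->|->]|[->|->]]; rewrite ?eqxx ?orbT; auto.
apply: (iffP andP) => [[/negP h1 /IH h2]|h]; first by constructor=> // /inP.
by inversion h; subst; split; [apply/negP => /inP|apply/IH].
Qed.

Section SignParts.
Variable Lambda : Type.
Implicit Types s : seq (Lambda * int).

Definition posword s : seq Lambda := flatten [seq nseq (mpos p.2) p.1 | p <- s].
Definition negword s : seq Lambda := flatten [seq nseq (mneg p.2) p.1 | p <- s].

End SignParts.

Lemma ip_badj (R : realType) (H1 H2 : hilbert R) (B : bop H1 H2) x y : ip (badj B y) x = ip y (B x).
Proof. by rewrite ip_conj -badj_spec -ip_conj. Qed.

Section RegularProducts.
Variables (R : realType) (Lambda : eqType) (H : hilbert R) (T : Lambda -> bop H H).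
Implicit Types s : seq (Lambda * int).

Lemma word_nseq (X : Type) (t : Lambda -> X -> X) n a x : word t (nseq n a) x = iter n (t a) x.
Proof. by elim: n => //= n ->. Qed.

Lemma posprodE s x : posprod T s x = word T (posword s) x.
Proof. by elim: s => //= p s IH; rewrite /posword /= word_cat word_nseq IH. Qed.

Lemma adjprodE s x : adjprod T s x = word (fun a => badj (T a)) (negword s) x.
Proof. by elim: s => //= p s IH; rewrite /negword /= word_cat word_nseq IH. Qed.

Lemma word_adj p (x y : H) : ip (word (fun a => badj (T a)) p x) y = ip x (word T (rev p) y).
Proof.
elim: p y => //= a p IH y; rewrite rev_cons -cats1 word_cat -IH /=.
by rewrite ip_badj.
Qed.

(** The indices are distinct, so each letter carries a single exponent and hence a single sign. This
    is how the regularity formula falls within the disjoint words for which the kernel is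
    prescribed. *)
Lemma disjoint_posneg s : uniq (map fst s) -> disjoint_words (posword s) (rev (negword s)).
Proof.
move=> us; apply/allP => a /flattenP[_ /mapP[p ps ->]]; rewrite mem_nseq => /andP[pp /eqP ->].
rewrite mem_rev; apply/negP => /flattenP[_ /mapP[r rs ->]]; rewrite mem_nseq => /andP[rp /eqP e].
have er : p = r.
  move: us ps rs e; elim: (s) => //= z l IH /andP[zl ul]; rewrite !inE.
  case/orP => [/eqP ->|pl]; case/orP => [/eqP ->|rl] //= e; last exact: IH.
    by rewrite e map_f in zl.
  by rewrite -e map_f in zl.
by move: pp rp; rewrite er; case: r.2.
Qed.

End RegularProducts.

Section UnitaryReordering.
Variables (R : realType) (Lambda : eqType) (K : hilbert R).
Variables (q : Lambda -> Lambda -> R[i]) (U : Lambda -> bop K K).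
Hypothesis q_unit : forall a b, a != b -> `|q a b| = 1.
Hypothesis U_unit : forall a, Defs.is_unitary (U a).
Hypothesis U_comm : forall a b, a != b -> forall y : K, U a (U b y) = q a b *: U b (U a y).

Lemma bop_lin (H1 H2 : hilbert R) (B : bop H1 H2) : linear_map B.
Proof. exact: bfun_linear. Qed.

Lemma badj_lin (H1 H2 : hilbert R) (B : bop H1 H2) : linear_map (badj B).
Proof.
by move=> a x y; apply: ip_ext => z; rewrite ip_linl !ip_badj ip_linl.
Qed.

Lemma iter_lin (F : K -> K) n : linear_map F -> linear_map (iter n F).
Proof. by move=> FL; elim: n => [|n IH] a x y; rewrite ?iterS ?IH ?FL. Qed.

Lemma unitary_adj_comm a b y : a != b -> U a (badj (U b) y) = q a b ^ (- 1) *: badj (U b) (U a y).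
Proof.
move=> ab; have := U_comm ab (badj (U b) y); rewrite (proj2 (U_unit b)) => ->.
rewrite linZ; last exact: badj_lin.
by rewrite (proj1 (U_unit b)) scalerA exprN1 mulVf ?scale1r // unit_neq0 // q_unit.
Qed.

Lemma iter_unitary_adj_comm a b n m y : a != b ->
  iter n (U a) (iter m (badj (U b)) y) = q a b ^ (- (n * m)%:Z) *: iter m (badj (U b)) (iter n (U
    a) y).
Proof.
move=> ab; have q0 := unit_neq0 (q_unit ab).
have step j z : U a (iter j (badj (U b)) z) = q a b ^ (- j%:Z) *: iter j (badj (U b)) (U a z).
  elim: j z => [|j IH] z; first by rewrite expr0z scale1r.
  rewrite iterS unitary_adj_comm // IH linZ; last exact: badj_lin.
  by rewrite scalerA -expfzDr //; congr (_ ^ _ *: _); lia.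
elim: n => [|n IH]; first by rewrite mul0n expr0z scale1r.
rewrite iterS IH linZ ?step; last exact: bop_lin.
by rewrite scalerA -expfzDr //; congr (_ ^ _ *: _); lia.
Qed.

(** A positive power of [U a] moves right past the adjoints of the later letters, each crossing of
    [U b] adjoint costing q_ab^(-1), while a negative power already stands in its place. This is the
    origin of the exponents in [qcoef]. *)
Lemma uprod_reorder (s : seq (Lambda * int)) (y : K) : uniq (map fst s) ->
  uprod U s y = qcoef q s *: adjprod U s (posprod U s y).
Proof.
elim: s => [|[a m] s IH] /=; first by rewrite scale1r.
case/andP => as_ us; rewrite {}IH //; case: m => n /=; last first.
  rewrite big1 ?mul1r; last by move=> p _; rewrite mul0n expr0z.
  by rewrite linZ; [rewrite linZ //; exact: badj_lin|exact/iter_lin/badj_lin].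
rewrite linZ; last exact/iter_lin/bop_lin.
have push z : iter n (U a) (adjprod U s z) =
    (\prod_(p <- s) q a p.1 ^ (- (n * mneg p.2)%:Z)) *: adjprod U s (iter n (U a) z).
  elim: s as_ {us} z => [|[b m] s IHs] /=; first by move=> _ z; rewrite big_nil scale1r.
  rewrite inE negb_or => /andP[ab as_] z.
  rewrite iter_unitary_adj_comm // IHs // big_cons /= -scalerA linZ //.
  exact/iter_lin/badj_lin.
by rewrite push mulrC -scalerA.
Qed.

End UnitaryReordering.

(** * Brehmer's condition implies dilation *)

Section Brehmer.
Variables (R : realType) (Lambda : eqType) (H : hilbert R).
Local Notation C := R[i].
Variables (q : Lambda -> Lambda -> C) (T : Lambda -> bop H H).
Hypothesis q_unit : forall a b, a != b -> `|q a b| = 1.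
Hypothesis q_inv : forall a b, a != b -> q a b = (q b a)^-1.
Hypothesis T_comm : forall a b, a != b -> forall x, T a (T b x) = q a b *: T b (T a x).
Hypothesis T_psd : forall u, uniq u -> psd (defect T u (@ip R H)).

Theorem brehmer : regular_q_unitary_dilation q T.
Proof.
pose Tf a := (T a : H -> H).
have T_lin a c x y : Tf a (c *: x + y) = c *: Tf a x + Tf a y by exact: bfun_linear.
have T_adj a x y : ip (Tf a x) y = ip x (badj (T a) y) by exact: badj_spec.
have T_comm' a b x : a != b -> Tf a (Tf b x) = q a b *: Tf b (Tf a x) by move=> ab; exact: T_comm.
pose k := word_kernel q Tf.
have kP : psd k by apply: word_kernel_psd.
have kH x y : k y x = (k x y)^*%C by apply: word_kernel_herm.
have [K [e [eE e_dense]]] := kolmogorov kP kH.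
have e_ext (c : C) x y : (forall z, k x z = c * k y z) -> e x = c *: e y.
  move=> xy; apply/eqP; rewrite -subr_eq0; apply/negPn/negP => /(@ip_posdef R K).
  have eB z : ip (e x - c *: e y) (e z) = 0 by rewrite -scaleN1r ip_addl !ip_sc !eE xy mulN1r subrr.
  by rewrite -[X in ip _ (_ + X)]scaleN1r ip_addr !ip_scr !eB !mulr0 addr0 ltxx.
pose v (h : H) := e ([::], h).
have vE h g : ip (v h) (v g) = ip h g.
  by rewrite eE; exact: (word_kernel_positive q_unit q_inv T_lin T_comm' T_psd (p := [::]) (p' :=
    [::])).
have v_lin : linear_map v.
  move=> c x y; apply/eqP; rewrite -subr_eq0; apply/eqP/hnorm_le0.
  rewrite -(ler_pXn2r (_ : 0 < 2)%N) ?nnegrE ?hnorm_ge0 // expr0n /=.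
  have -> : v (c *: x + y) - (c *: v x + v y) = v (c *: x + y) + (- c) *: v x + (-1) *: v y.
    by rewrite scaleNr scaleN1r opprD addrA.
  rewrite -lecR hnorm_sqr !(ip_addl, ip_addr, ip_sc, ip_scr, vE) rmorphN1 rmorphN /=.
  by rewrite le_eqVlt; apply/orP; left; apply/eqP; ring.
have v_norm h : hnorm (v h) = hnorm h by rewrite /hnorm vE.
have comb_norm (f : seq (Lambda * bool) * H -> K) (s : seq (C * (seq (Lambda * bool) * H))) :
    (forall x y, ip (f x) (f y) = k x y) ->
    hnorm (\sum_(p <- s) p.1 *: f p.2) = hnorm (\sum_(p <- s) p.1 *: e p.2).
  move=> fE; rewrite /hnorm !ip_comb; congr (Num.sqrt (complex.Re _)).
  by apply: eq_bigr => p _; apply: eq_bigr => r _; rewrite fE eE.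
(* Prefixing a letter preserves the kernel, hence the norms of combinations, so it extends to the
   whole space; the two signs of a letter will give [U a] and its adjoint. *)
have [W hW] : exists W : Lambda * bool -> K -> K, forall l, [/\ linear_map (W l),
    forall x, hnorm (W l x) <= hnorm x & forall w h, W l (e (w, h)) = e (l :: w, h)].
  have ex l : exists F : K -> K, [/\ linear_map F, forall x, hnorm (F x) <= hnorm x &
      forall w h, F (e (w, h)) = e (l :: w, h)].
    have [|F [F1 F2 F3]] := @extend_contraction R K _ e e_dense K (fun z => e (l :: z.1, z.2));
      last by exists F; split=> // w h; rewrite F3.
    by move=> s; rewrite (comb_norm (fun z => e (l :: z.1, z.2))) // => x y; rewrite eE;
      exact: word_kernel_letter.
  by exists (fun l => projT1 (cid (ex l))) => l; exact: projT2 (cid (ex l)).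
have W_lin l : linear_map (W l) by case: (hW l).
have W_norm l x : hnorm (W l x) <= hnorm x by case: (hW l).
have W_e l w h : W l (e (w, h)) = e (l :: w, h) by case: (hW l).
have W_cancel a b x : W (a, b) (W (a, ~~ b) x) = x.
  apply: (dense_eq e_dense (M := 1) (F := fun x => W (a, b) (W (a, ~~ b) x)) (G := id)) => //.
  - by move=> c y z; rewrite !W_lin.
  - by move=> y; rewrite mul1r; apply: le_trans (W_norm _ _) (W_norm _ _).
  - by move=> y; rewrite mul1r.
  - move=> [w h] /=; rewrite !W_e -[RHS]scale1r; apply: e_ext => z; rewrite mul1r.
    exact: (word_kernel_cancel q_unit q_inv T_lin T_comm' T_psd a b (w, h) z).
have W_iso l x : hnorm (W l x) = hnorm x.
  apply/eqP; rewrite eq_le W_norm /=; case: l => a b.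
  have := W_norm (a, ~~ b) (W (a, b) x); by have := W_cancel a (~~ b) x; rewrite negbK => ->.
have W_adj a b x y : ip (W (a, b) x) y = ip x (W (a, ~~ b) y).
  by rewrite -{1}[y](W_cancel a b) (polarization (W_lin (a, b))).
have W_bop l : exists M : R, forall x, hnorm (W l x) <= M * hnorm x.
  by exists 1 => x; rewrite mul1r.
pose U a := @BOp R K K (W (a, true)) (W (a, false)) (W_lin (a, true)) (W_bop (a, true)) (W_adj a
  true).
have U_unit a : Defs.is_unitary (U a).
  by split=> x; [exact: (W_cancel a false)|exact: (W_cancel a true)].
have U_comm a b : a != b -> forall y, U a (U b y) = q a b *: U b (U a y).
  move=> ab; apply: (dense_eq e_dense (M := 1) (F := fun x => U a (U b x))
      (G := fun x => q a b *: U b (U a x))) => /=.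
  - by move=> c y z; rewrite !W_lin.
  - by move=> c y z; rewrite !W_lin scalerDr !scalerA mulrC.
  - by move=> y; rewrite !W_iso mul1r.
  - by move=> y; rewrite hnormZ !W_iso mul1r /cabs q_unit // mul1r.
  - move=> [w h] /=; rewrite !W_e; apply: e_ext => z.
    exact: (word_kernel_comm q_unit q_inv T_lin T_comm' T_psd (w, h) z ab).
(* The map from [e z] to [p z] is to become the adjoint of the embedding [v]. *)
pose p z := projT1 (cid (word_kernel_repr q T_adj z)).
have pE z g : ip (p z) g = k z ([::], g) := esym (projT2 (cid (word_kernel_repr q T_adj z)) g).
have ip_suml (K' : hilbert R) (X : Type) (f : X -> K') (t : seq (C * X)) y :
    ip (\sum_(r <- t) r.1 *: f r.2) y = \sum_(r <- t) r.1 * ip (f r.2) y.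
  by elim: t => [|r t IH]; rewrite ?big_nil ?ip0l // !big_cons ip_addl ip_sc IH.
have p_contr (t : seq (C * (seq (Lambda * bool) * H))) :
    hnorm (\sum_(r <- t) r.1 *: p r.2) <= hnorm (\sum_(r <- t) r.1 *: e r.2).
  set w := \sum_(r <- t) r.1 *: p r.2; set E := \sum_(r <- t) r.1 *: e r.2.
  (* This identity gives ||w||^2 <= ||E|| ||v w|| = ||E|| ||w||, so the prospective adjoint is
     contractive. *)
  have wE : ip w w = ip E (v w).
    by rewrite {1}/w /E !ip_suml; apply: eq_bigr => r _; rewrite pE eE.
  have := ip_cauchy_schwarz E (v w); rewrite -wE -hnorm_sqr v_norm.
  have -> : cabs (hnorm w ^+ 2)%:C = hnorm w ^+ 2.
    by rewrite /cabs ger0_norm // ler0c sqr_ge0.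
  have := hnorm_ge0 w; rewrite le_eqVlt => /orP[/eqP <- _|w0]; first exact: hnorm_ge0.
  by rewrite expr2 ler_pM2r.
have [P [P_lin P_norm P_e]] := extend_contraction e_dense p_contr.
have V_adj h phi : ip (v h) phi = ip h (P phi).
  apply/eqP; rewrite -subr_eq0; apply/eqP/cabs_le0; move: phi.
  apply: (@dense_vanish R K _ e e_dense (fun phi => cabs (ip (v h) phi - ip h (P phi))) (2 *
    hnorm h)).
    by rewrite mulr_ge0 ?hnorm_ge0.
  move=> phi t; set c := \sum_(r <- t) _.
  have cE : ip (v h) c = ip h (P c).
    rewrite ip_conj [RHS]ip_conj; congr (conjc _); rewrite /c (lin_sum _ _ P_lin) (ip_suml _ _ e)
      (ip_suml _ _ (fun z => P (e z))).
    by apply: eq_bigr => r _; rewrite P_e pE eE.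
  have -> : ip (v h) phi - ip h (P phi) = ip (v h) (phi - c) - ip h (P (phi - c)).
    by rewrite (linB P_lin) !ip_subr cE opprB addrA subrK.
  apply: le_trans (cabsD _ _) _; rewrite cabsN.
  have h1 := ip_cauchy_schwarz (v h) (phi - c); have h2 := ip_cauchy_schwarz h (P (phi - c)).
  rewrite v_norm in h1; have h3 := P_norm (phi - c); have h4 := hnorm_ge0 h.
  nra.
have V_bop : exists M : R, forall x, hnorm (v x) <= M * hnorm x.
  by exists 1 => x; rewrite v_norm mul1r.
pose V := @BOp R H K v P v_lin V_bop V_adj.
exists K, V, U; split; first exact: v_norm.
split; first exact: U_unit.
split; first by move=> a b /eqP; exact: U_comm.
move=> s /uniq_NoDup us x; apply: ip_ext => g.
rewrite ip_badj (uprod_reorder q_unit U_unit U_comm) // !ip_sc; congr (_ * _).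
(* Tested against [g], the adjoint factors move to the right slot as a reversed positive word. Both
   sides then compare the same pair of disjoint positive words, in [H] and in [K]. *)
rewrite !posprodE !adjprodE !word_adj.
have wordU r h : word (fun a => U a : K -> K) r (e ([::], h)) = e ([seq (a, true) | a <- r], h).
  by elim: r => //= a r ->; rewrite W_e.
rewrite /= /v !wordU eE.
by symmetry; apply: (word_kernel_positive q_unit q_inv T_lin T_comm' T_psd); exact: disjoint_posneg.
Qed.

End Brehmer.

(** * Brehmer's condition in the three cases *)

(** A positive first increment would by convexity bound all later increments from below, and linear
    growth would exceed [M]. *)
Lemma convex_bounded_le (R : realType) (n : nat -> R) (M : R) :
  (forall j, 2 * n j.+1 <= n j + n j.+2) -> (forall j, n j <= M) -> n 1%N <= n 0%N.
Proof.
move=> cvx nM; rewrite leNgt; apply/negP => n01; pose d := n 1%N - n 0%N.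
have d0 : 0 < d by rewrite subr_gt0.
have inc j : d <= n j.+1 - n j by elim: j => // j IH; have := cvx j; lra.
have grow j : n 0%N + j%:R * d <= n j.
  by elim: j => [|j IH]; [rewrite mul0r addr0|have := inc j; rewrite -natr1; lra].
have := grow (Num.truncn ((M - n 0%N) / d)).+1; have := nM (Num.truncn ((M - n 0%N) / d)).+1.
have := truncnS_gt ((M - n 0%N) / d); rewrite ltr_pdivrMr //; lra.
Qed.

Section QuadraticDefect.
Variables (R : realType) (Lambda : eqType) (H : hilbert R).
Local Notation C := R[i].
Variables (q : Lambda -> Lambda -> C) (T : Lambda -> bop H H).
Hypothesis q_unit : forall a b, a != b -> `|q a b| = 1.
Hypothesis q_inv : forall a b, a != b -> q a b = (q b a)^-1.
Hypothesis T_contr : forall a, is_contraction (T a).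
Hypothesis T_comm : forall a b, a != b -> forall x, T a (T b x) = q a b *: T b (T a x).

Local Notation form u := (defect (fun a => T a : H -> H) u (@ip R H)).

Lemma form_linl u a x y z : form u (a *: x + y) z = a * form u x z + form u y z.
Proof.
elim: u x y z => [|b u IH] x y z /=; first exact: ip_linl.
by rewrite bfun_linear !IH; ring.
Qed.

Lemma form_herm u x y : form u y x = (form u x y)^*%C.
Proof.
elim: u x y => [|b u IH] x y /=; first exact: ip_conj.
by rewrite rmorphB /= -!IH.
Qed.

Lemma form_addl u x y z : form u (x + y) z = form u x z + form u y z.
Proof. by rewrite -[x]scale1r form_linl mul1r scale1r. Qed.

Lemma form_scl u a x y : form u (a *: x) y = a * form u x y.
Proof.
have f0 : form u 0 y = 0.
  have := form_addl u 0 0 y; rewrite addr0 => /eqP.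
  by rewrite -subr_eq0 opprD addrA subrr sub0r oppr_eq0 => /eqP.
by rewrite -[a *: x]addr0 form_linl f0 addr0.
Qed.

Lemma form_scr u a x y : form u x (a *: y) = a^*%C * form u x y.
Proof. by rewrite form_herm form_scl rmorphM /= -form_herm. Qed.

(** By sesquilinearity the double sum is the value of the form on the diagonal at one linear
    combination. *)
Lemma form_psd u : (forall x, 0 <= form u x x) -> psd (form u).
Proof.
move=> f0 s; have := f0 (\sum_(p <- s) p.1 *: p.2); congr (0 <= _).
have suml (t : seq (C * H)) y : form u (\sum_(p <- t) p.1 *: p.2) y = \sum_(p <- t) p.1 * form u
  p.2 y.
  elim: t => [|r t IH]; last by rewrite !big_cons form_linl IH.
  by rewrite !big_nil -[0 : H](scale0r 0) form_scl mul0r.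
rewrite suml; apply: eq_bigr => p _.
rewrite form_herm suml rmorph_sum mulr_sumr; apply: eq_bigr => r _.
by rewrite rmorphM /= -form_herm mulrA.
Qed.

Fixpoint quad (u : seq Lambda) (x : H) : R :=
  if u is a :: u' then quad u' x - quad u' (T a x) else hnorm x ^+ 2.

Lemma formE u x : form u x x = (quad u x)%:C.
Proof.
elim: u x => [|a u IH] x /=; first by rewrite hnorm_sqr.
by rewrite !IH -rmorphB.
Qed.

Lemma dilation_of_quad_ge0 :
  (forall u x, uniq u -> 0 <= quad u x) -> regular_q_unitary_dilation q T.
Proof.
move=> Q0; apply: brehmer => // u uu; apply: form_psd => x.
by rewrite formE ler0c Q0.
Qed.

(** For nonempty [u] the two terms of the difference coincide, so the form vanishes. *)
Lemma quad_isometry : (forall a, Defs.is_isometry (T a)) -> forall u x, 0 <= quad u x.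
Proof.
move=> Ti; have inv u b x : quad u (T b x) = quad u x.
  by elim: u b x => [|c u IH] b x /=; rewrite ?Ti // !IH !subrr.
by case=> [|a u] x /=; rewrite ?inv ?subrr ?sqr_ge0.
Qed.

(** Contractivity bounds the set whose supremum is [opnorm], so that the supremum is a genuine upper
    bound. *)
Lemma le_opnorm a x : hnorm (T a x) <= opnorm (T a) * hnorm x.
Proof.
have [x0|x0] := ltrP 0 (hnorm x); last first.
  have -> : x = 0 by exact: hnorm_le0.
  by rewrite (lin0 (bop_lin (T a))) !hnorm0 mulr0.
rewrite -ler_pdivrMr //; pose y := ((hnorm x)^-1)%:C *: x.
have cx : cabs ((hnorm x)^-1)%:C = (hnorm x)^-1.
  by rewrite /cabs ger0_norm // ler0c invr_ge0 ltW.
have -> : hnorm (T a x) / hnorm x = hnorm (T a y).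
  by rewrite /y (linZ (bop_lin (T a))) hnormZ cx mulrC.
apply: ub_le_sup; last first.
  by exists y; split=> //; rewrite hnormZ cx mulVf // gt_eqF.
by exists 1 => _ [z [z1 ->]]; apply: le_trans (T_contr a z) z1.
Qed.

(** A two-sided bound closes the induction. The subtracted term is at most ||T_a||^2 ||x||^2 by its
    upper bound, which costs one summand below; it is nonnegative by its lower bound, which
    preserves the estimate above. *)
Lemma quad_summable :
  (forall s, uniq s -> \sum_(a <- s) opnorm (T a) ^+ 2 <= 1) ->
  forall u x, uniq u -> 0 <= quad u x.
Proof.
move=> Ts u; suff both x : uniq u ->
    (1 - \sum_(a <- u) opnorm (T a) ^+ 2) * hnorm x ^+ 2 <= quad u x <= hnorm x ^+ 2.
  move=> x uu; have /andP[+ _] := both x uu; apply: le_trans.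
  by rewrite mulr_ge0 ?sqr_ge0 // subr_ge0 Ts.
elim: u x => [|a u IH] x /=; first by rewrite big_nil subr0 mul1r lexx.
case/andP=> _ uu; have /andP[h1 h2] := IH x uu; have /andP[h3 h4] := IH (T a x) uu.
have h5 : 0 <= quad u (T a x).
  by apply: le_trans h3; rewrite mulr_ge0 ?sqr_ge0 // subr_ge0 Ts.
have h6 : hnorm (T a x) ^+ 2 <= opnorm (T a) ^+ 2 * hnorm x ^+ 2.
  rewrite -exprMn ler_pXn2r ?nnegrE ?hnorm_ge0 ?le_opnorm //.
  exact: le_trans (hnorm_ge0 _) (le_opnorm a x).
rewrite big_cons; apply/andP; split; lra.
Qed.

(** * The doubly commuting case *)

Section DoublyCommuting.
Hypothesis T_dcomm : forall a b, a != b ->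
  forall x, T a (badj (T b) x) = (q a b)^*%C *: badj (T b) (T a x).

(** Moving T_a past T_b in the first slot produces the phase q_ba, and moving the adjoint of T_a
    past T_b in the second slot produces the same phase after conjugation. *)
Lemma form_adj u a x y : a \notin u -> form u (T a x) y = form u x (badj (T a) y).
Proof.
elim: u x y => [|b u IH] x y /=; first by rewrite badj_spec.
rewrite inE negb_or => /andP[ab au]; have ba : b != a by rewrite eq_sym.
rewrite !IH // T_comm // form_scl !IH // T_dcomm // form_scr conjcK.
by [].
Qed.

Lemma quad_doubly_commuting u x : uniq u -> 0 <= quad u x.
Proof.
(* The upper bound is carried along because it dominates the seminorm of the form by the norm of
   [H], which bounds the sequence of iterates below. *)
suff both : uniq u -> forall x, 0 <= quad u x <= hnorm x ^+ 2.
  by move=> uu; case/andP: (both uu x).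
elim: u {x} => [|a u IH] /=; first by move=> _ x; rewrite sqr_ge0 lexx.
case/andP => au uu x; have {}IH := IH uu.
have f0 y : 0 <= form u y y by rewrite formE ler0c; case/andP: (IH y).
pose nrm := snorm (form u).
have nrm_sqr y : nrm y ^+ 2 = quad u y by rewrite (snorm_sqrE f0) formE.
have cs := cauchy_schwarz (form_addl u) (form_scl u) (form_herm u) f0.
(* A = T_a^* T_a is symmetric for the positive form, so |A^j x| is convex in j by Cauchy-Schwarz;
   being bounded, it decreases.  This replaces the square root of a positive operator. *)
pose A y := badj (T a) (T a y).
have A_sym y z : form u (A y) z = form u y (A z).
  by rewrite /A -form_adj // form_herm -form_adj // -form_herm.
have A_contr y : hnorm (A y) <= hnorm y.
  have [->|/eqP n0] := eqVneq (hnorm (A y)) 0; first exact: hnorm_ge0.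
  have n1 : 0 < hnorm (A y) by rewrite lt_neqAle eq_sym hnorm_ge0 andbT; apply/eqP.
  rewrite -(ler_pM2l n1) -expr2.
  have -> : hnorm (A y) ^+ 2 = cabs (ip (T a y) (T a (A y))).
    by rewrite -ip_badj -/(A y) -hnorm_sqr /cabs ger0_norm // ler0c sqr_ge0.
  apply: le_trans (ip_cauchy_schwarz _ _) _.
  rewrite mulrC; apply: ler_pM; rewrite ?hnorm_ge0 //; exact: T_contr.
have Ax : nrm (A x) <= nrm x.
  apply: (@convex_bounded_le R (fun j => nrm (iter j A x)) (hnorm x)) => j.
    have h : nrm (iter j.+1 A x) ^+ 2 <= nrm (iter j A x) * nrm (iter j.+2 A x).
      rewrite nrm_sqr.
      have -> : quad u (iter j.+1 A x) = cabs (form u (iter j A x) (iter j.+2 A x)).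
        by rewrite (iterS j.+1) -A_sym -iterS formE /cabs ger0_norm // ler0c;
          case/andP: (IH (iter j.+1 A x)).
      exact: cs.
    have := snorm_ge0 (form u) (iter j A x); have := snorm_ge0 (form u) (iter j.+2 A x).
    have := snorm_ge0 (form u) (iter j.+1 A x); rewrite -!/(nrm _) => h1 h2 h3.
    (* From b^2 <= a c follows (2 b)^2 <= 4 a c <= (a + c)^2, which is the convexity required. *)
    rewrite -(ler_pXn2r (_ : 0 < 2)%N) ?nnegrE ?addr_ge0 ?mulr_ge0 //.
    have := sqr_ge0 (nrm (iter j A x) - nrm (iter j.+2 A x)); nra.
  have le_h y : nrm y <= hnorm y.
    rewrite -(ler_pXn2r (_ : 0 < 2)%N) ?nnegrE ?hnorm_ge0 ?snorm_ge0 // nrm_sqr.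
    by case/andP: (IH y).
  by apply: le_trans (le_h _) _; elim: j => //= j; apply: le_trans.
apply/andP; split; last first.
  have /andP[_ h1] := IH x; have /andP[h2 _] := IH (T a x); lra.
rewrite subr_ge0.
(* By [form_adj] the subtracted term is the form at [x] and [A x], which Cauchy-Schwarz and [Ax]
   bound by [nrm x ^+ 2]. *)
have -> : quad u (T a x) = cabs (form u x (A x)).
  by rewrite -form_adj // formE /cabs ger0_norm // ler0c; case/andP: (IH (T a x)).
apply: le_trans (cs _ _) _; rewrite -nrm_sqr expr2 ler_wpM2l //; exact: snorm_ge0.
Qed.

End DoublyCommuting.
End QuadraticDefect.

Theorem theorem1p13 (R : realType) (Lambda : Type) (H : hilbert R)
    (q : Lambda -> Lambda -> R[i]) (T : Lambda -> bop H H) :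
  (forall a b : Lambda, a <> b -> `|q a b| = 1) ->
  (forall a b : Lambda, a <> b -> q a b = (q b a)^-1) ->
  (forall a : Lambda, is_contraction (T a)) ->
  (forall a b : Lambda, a <> b -> forall x : H, T a (T b x) = q a b *: T b (T a x)) ->
  (* (1) every T_a is an isometry *)
  ((forall a : Lambda, is_isometry (T a)) -> regular_q_unitary_dilation q T) /\
  (* (2) doubly q-commuting *)
  ((forall a b : Lambda, a <> b ->
      forall x : H, T a (badj (T b) x) = (q a b)^* *: badj (T b) (T a x)) ->
    regular_q_unitary_dilation q T) /\
  (* (3) Lambda countable and sum_a ||T_a||^2 <= 1 *)
  ((exists f : Lambda -> nat, injective f) ->
   (forall s : seq Lambda, List.NoDup s -> \sum_(a <- s) opnorm (T a) ^+ 2 <= 1) ->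
    regular_q_unitary_dilation q T).
Proof.
move=> q_unit q_inv T_contr T_comm.
(* [{classic Lambda}] is [Lambda] with classically decided equality, so the propositional [<>] of
   the statement becomes the boolean [!=] of the preceding sections. *)
have q_unit' (a b : {classic Lambda}) : a != b -> `|q a b| = 1 by move/eqP; exact: q_unit.
have q_inv' (a b : {classic Lambda}) : a != b -> q a b = (q b a)^-1 by move/eqP; exact: q_inv.
have T_comm' (a b : {classic Lambda}) : a != b -> forall x, T a (T b x) = q a b *: T b (T a x).
  by move/eqP; exact: T_comm.
have dilate := @dilation_of_quad_ge0 R {classic Lambda} H q T q_unit' q_inv' T_comm'.
split; [|split].
- by move=> Ti; apply: dilate => u x _; exact: quad_isometry.
- move=> T_dcomm; apply: dilate => u x; apply: (@quad_doubly_commuting R {classic Lambda} H q T)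
  => //.
  by move=> a b /eqP; exact: T_dcomm.
- move=> _ Ts; apply: dilate; apply: (@quad_summable R {classic Lambda} H T) => // s /uniq_NoDup;
  exact: Ts.
Qed.
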